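(* Let $(W,S)$ be a Coxeter system of rank $n$ with associated bilinear form $B$ on $V$; assume that $B$ has signature $(n-1,1)$ and is irreducible. Suppose that for every subset $S'\subset S$ with $n'=|S'|\ge 3$, the bilinear form associated with the Coxeter subgroup generated by $S'$ (that is, the restriction of $B$ to $\mathrm{span}\{\alpha_s : s\in S'\}$) is either positive definite or of signature $(n'-1,1)$. Let $\partial_G W$ be the Gromov boundary of $W$ (with respect to $S$) and let $\Lambda(W)$ be the limit set of $W$. Then there exists a $W$-equivariant continuous surjection $F:\partial_G W\to\Lambda(W)$.
   Context: Coxeter system: $W$ is generated by $S=\{s_1,\dots,s_n\}$ with relations $(s_is_j)^{m_{ij}}=1$, where $m_{ii}=1$ and $m_{ij}=m_{ji}\in\{2,3,\dots\}\cup\{\infty\}$ for $i\ne j$ (no relation if $m_{ij}=\infty$). $V$ is a real vector space with basis $\Delta=\{\alpha_1,\dots,\alpha_n\}$ ($\alpha_i=\alpha_{s_i}$), declared orthonormal for a Euclidean inner product, so $V\cong\mathbb{R}^n$. $B$ is a symmetric bilinear form on $V$ with $B(\alpha_i,\alpha_j)=-\cos(\pi/m_{ij})$ if $m_{ij}<\infty$ (so $B(\alpha_i,\alpha_i)=1$) and $B(\alpha_i,\alpha_j)$ a fixed real number $\le -1$ if $m_{ij}=\infty$. $B$ is irreducible if its Gram matrix $(B(\alpha_i,\alpha_j))_{i,j}$ is not block-diagonal up to permutation of the basis. Signature $(p,q)$ means $p$ positive and $q$ negative eigenvalues. $W$ acts linearly on $V$ by letting $s_i$ act as $v\mapsto v-2B(\alpha_i,v)\alpha_i$;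 the image of $v$ under $w$ is written $w(v)$. Let $o=\sum_i o_i\alpha_i$ be the eigenvector for the negative eigenvalue of the Gram matrix with Euclidean norm $1$ and all $o_i>0$ (it exists under the assumptions). For $v=\sum_i v_i\alpha_i$ put $|v|_1=\sum_i o_iv_i$, let $V_1=\{v\in V: |v|_1=1\}$, and $\widehat v=v/|v|_1$ when $|v|_1\neq0$. Let $D=\{v\in V_1: B(v,v)<0\}$ (a bounded open ellipsoid in $V_1$ containing $o$) and $\partial D=\{v\in V_1: B(v,v)=0\}$. The normalized action of $W$ on $D\cup\partial D$ is $w\cdot x=\widehat{w(x)}$. The limit set $\Lambda(W)$ is the set of accumulation points of the orbit $W\cdot o$ in the Euclidean topology; $W$ acts on it by the normalized action. Gromov boundary: equip $W$ with the word metric $d(g,h)=|g^{-1}h|_S$ and base point the identity $e$; the Gromov product is $(x|y)=\tfrac12(d(x,e)+d(y,e)-d(x,y))$. A sequence $(x_i)$ is a Gromov sequence if $(x_i|x_j)\to\infty$ as $i,j\to\infty$. Write $x\sim_G y$ for Gromov sequences with $\liminf_{i,j\to\infty}(x_i|y_j)=\infty$, and let $\sim$ be the equivalence relation given by finite chains of $\sim_G$. $\partial_G W$ is the set of equivalence classes of Gromov sequences, with $W$ acting by left multiplication. For $a\neq b$ in $\partial_GW$, $(a|b)=\inf\{\liminf_{i,j\to\infty}(x_i|y_j): [x]=a,[y]=b\}$, and $(a|a)=\infty$. The topology on $\partial_GW$ has as subbasis the sets $\{b\in\partial_GW: (a|b)>r\}$, $a\in\partial_GW$, $r>0$. *)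

(* Defs.v *)
From Stdlib Require Import Relation_Operators.
From HB Require Import structures.
From mathcomp Require Import all_boot all_order all_algebra all_fingroup.
From mathcomp Require Import generic_quotient.
From mathcomp Require Import all_classical all_reals all_analysis.
From mathcomp Require Import lra.

Set Implicit Arguments.
Unset Strict Implicit.
Unset Printing Implicit Defensive.

Import Order.TTheory GRing.Theory Num.Theory.
Import numFieldNormedType.Exports.

Local Open Scope classical_set_scope.
Local Open Scope ring_scope.

(* [None] stands for the label [m_ij = oo]. *)
Record coxeterMatrix (n : nat) := CoxeterMatrix {
  cox_label :> 'I_n -> 'I_n -> option nat ;
  cox_label_diag : forall i, cox_label i i = Some 1%N ;
  cox_label_sym : forall i j, cox_label i j = cox_label j i ;
  cox_label_ge2 : forall i j k, i != j -> cox_label i j = Some k -> (2 <= k)%N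
}.

Definition cox_relations n (m : coxeterMatrix n) (G : groupType)
    (g : 'I_n -> G) : Prop :=
  forall i j k, m i j = Some k -> ((g i * g j) ^+ k = 1)%g.

(* [W] is the group presented by the generators [s_i] and the Coxeter
   relations: the [s_i] satisfy the relations, generate [W], and every other
   family satisfying the relations factors through [W].  Positive words
   suffice for generation because [s_i ^ 2 = 1]. *)
Record coxeterSystem n (m : coxeterMatrix n) := CoxeterSystem {
  cox_group :> groupType ;
  cox_gen : 'I_n -> cox_group ;
  cox_gen_rel : cox_relations m cox_gen ;
  cox_gen_span : forall w : cox_group,
    exists u : seq 'I_n, (\prod_(i <- u) cox_gen i)%g = w ;
  cox_gen_univ : forall (G : groupType) (g : 'I_n -> G), cox_relations m g ->
    exists2 f : cox_group -> G, {morph f : x y / (x * y)%g} &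
      forall i, f (cox_gen i) = g i
}.

Section BilinearForm.
Variables (R : realType) (n : nat).
Implicit Types (m : coxeterMatrix n) (B : 'M[R]_n) (u v : 'cV[R]_n).

(* [V] is ['cV[R]_n], with [alpha i] its standard basis, and the form [B] is
   given by its Gram matrix in that basis. *)
Definition alpha (i : 'I_n) : 'cV[R]_n := delta_mx i 0.

Definition bform B u v : R := (u^T *m B *m v) 0 0.

Definition coxeter_form m B : Prop :=
  B^T = B /\
  forall i j, if m i j is Some k then B i j = - cos (pi / k%:R)
              else B i j <= -1.

(* [p] positive and [q] negative eigenvalues, counted with multiplicity. *)
Definition signature k (A : 'M[R]_k) (p q : nat) : Prop :=
  exists2 e : seq R, char_poly A = \prod_(a <- e) ('X - a%:P) &
    count (fun a => 0 < a) e = p /\ count (fun a => a < 0) e = q.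

Definition positive_definite k (A : 'M[R]_k) : Prop :=
  forall v : 'cV[R]_k, v != 0 -> 0 < (v^T *m A *m v) 0 0.

(* Some simultaneous permutation of rows and columns yields a matrix made of
   two nonempty diagonal blocks, of sizes [k] and [n - k]. *)
Definition reducible_form B : Prop :=
  exists (sigma : 'S_n) (k : nat), (0 < k < n)%N /\
    forall i j : 'I_n, (i < k)%N != (j < k)%N -> B (sigma i) (sigma j) = 0.

Definition irreducible_form B : Prop := ~ reducible_form B.

(* Gram matrix of the restriction of [B] to the span of the [alpha i],
   [i \in A]. *)
Definition gram_restr B (A : {set 'I_n}) : 'M[R]_#|A| :=
  mxsub (@enum_val _ (mem A)) (@enum_val _ (mem A)) B.

Definition geometric_action m (W : coxeterSystem m) B (rho : W -> 'M[R]_n) :=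
  [/\ rho 1%g = 1%:M,
      forall x y : W, rho (x * y)%g = rho x *m rho y &
      forall i v, rho (cox_gen W i) *m v = v - (2 * bform B (alpha i) v) *: alpha i].

(* [o]: the positive unit eigenvector for the negative eigenvalue. *)
Definition negative_direction B (o : 'cV[R]_n) : Prop :=
  [/\ exists2 lambda, lambda < 0 & B *m o = lambda *: o,
      \sum_i o i 0 ^+ 2 = 1 &
      forall i, 0 < o i 0].

Definition norm1 (o v : 'cV[R]_n) : R := \sum_i o i 0 * v i 0.

Definition normalize (o v : 'cV[R]_n) : 'cV[R]_n := (norm1 o v)^-1 *: v.

Definition normalized_action m (W : coxeterSystem m) (rho : W -> 'M[R]_n)
    (o : 'cV[R]_n) (w : W) (x : 'cV[R]_n) : 'cV[R]_n :=
  normalize o (rho w *m x).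

Definition limit_set m (W : coxeterSystem m) (rho : W -> 'M[R]_n)
    (o : 'cV[R]_n) : set 'cV[R]_n :=
  limit_point (range (fun w => normalized_action rho o w o)).

End BilinearForm.

Section WordMetric.
Variables (n : nat) (m : coxeterMatrix n) (W : coxeterSystem m).
Implicit Types g h w : W.

Lemma has_word w :
  exists k, [exists u : k.-tuple 'I_n, (\prod_(i <- u) cox_gen W i)%g == w].
Proof.
have [u uw] := cox_gen_span w.
by exists (size u); apply/existsP; exists (in_tuple u); apply/eqP.
Qed.

(* Since [s_i ^-1 = s_i], the word length for [S] is attained by positive words. *)
Definition word_length w : nat := ex_minn (has_word w).

Lemma word_lengthM g h :
  (word_length (g * h)%g <= word_length g + word_length h)%N.
Proof.
rewrite /word_length.
case: (ex_minnP (has_word g)) => kg /existsP[ug /eqP eg] _.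
case: (ex_minnP (has_word h)) => kh /existsP[uh /eqP eh] _.
case: ex_minnP => k _; apply; apply/existsP; exists (cat_tuple ug uh).
by rewrite big_cat /= eg eh.
Qed.

Definition word_dist g h : nat := word_length (g^-1 * h)%g.

Lemma word_distMl w g h : word_dist (w * g)%g (w * h)%g = word_dist g h.
Proof. by rewrite /word_dist invgM -mulgA mulKg. Qed.

Lemma word_distM1 w g :
  (word_dist g 1%g <= word_dist (w * g)%g 1%g + word_length w)%N.
Proof.
rewrite /word_dist !mulg1 invgM; apply: leq_trans (word_lengthM _ _).
by rewrite mulgVK.
Qed.

End WordMetric.

Section GromovBoundary.
Variables (R : realType) (n : nat) (m : coxeterMatrix n) (W : coxeterSystem m).
Implicit Types (w : W) (x y : nat -> W).

Definition gromov_product (g h : W) : R :=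
  ((word_dist g 1%g)%:R + (word_dist h 1%g)%:R - (word_dist g h)%:R) / 2.

Lemma gromov_productMl w g h :
  gromov_product g h - (word_length w)%:R <=
  gromov_product (w * g)%g (w * h)%g.
Proof.
rewrite /gromov_product word_distMl.
have := word_distM1 w g; have := word_distM1 w h.
rewrite -!(ler_nat R) !natrD; lra.
Qed.

Definition gromov_seq x : Prop :=
  gromov_product (x p.1) (x p.2) @[p --> filter_prod \oo \oo] --> +oo.

Definition gromov_liminf x y : \bar R :=
  limf_einf (fun p : nat * nat => (gromov_product (x p.1) (y p.2))%:E)
            (filter_prod \oo \oo).

Definition gseq : Type := {x : nat -> W | `[< gromov_seq x >]}.

HB.instance Definition _ := Choice.on gseq.

Definition gsim (x y : gseq) : Prop := gromov_liminf (val x) (val y) = +oo%E.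

(* [gsim] is reflexive on Gromov sequences, and symmetric, so the equivalence
   relation it generates is that of finite [gsim]-chains. *)
Definition gequiv (x y : gseq) : bool := `[< clos_refl_sym_trans _ gsim x y >].

Lemma gequiv_class : equiv_class_of gequiv.
Proof.
split=> [x|x y|y x z]; first exact/asboolP/rst_refl.
- by apply/asboolP/asboolP => xy; exact: rst_sym.
- by move=> /asboolP xy /asboolP yz; apply/asboolP; exact: rst_trans xy yz.
Qed.

Canonical gequiv_equiv := EquivRelPack gequiv_class.

Definition gromov_boundary : Type := {eq_quot gequiv}%qT.

HB.instance Definition _ := Choice.on gromov_boundary.
HB.instance Definition _ := EqQuotient.on gromov_boundary.

Definition boundary_class (x : gseq) : gromov_boundary :=
  (\pi_gromov_boundary x)%qT.

Definition boundary_product (a b : gromov_boundary) : \bar R :=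
  if a == b then +oo%E
  else ereal_inf [set r | exists x y : gseq,
         [/\ boundary_class x = a, boundary_class y = b &
             r = gromov_liminf (val x) (val y)]].

Definition boundary_subbasis : set (set gromov_boundary) :=
  [set U | exists (a : gromov_boundary) (r : R),
     0 < r /\ U = [set b | (r%:E < boundary_product a b)%E]].

HB.instance Definition _ :=
  isSubBaseTopological.Build gromov_boundary boundary_subbasis id.

Lemma gromov_seqMl w x : gromov_seq x -> gromov_seq (fun i => w * x i)%g.
Proof.
move=> /cvgryPge xoo; apply/cvgryPge => M.
apply: filterS (xoo (M + (word_length w)%:R)) => p; rewrite -lerBrDr => /le_trans.
by apply; exact: gromov_productMl.
Qed.

Definition gseq_mul w (x : gseq) : gseq :=
  exist _ (fun i => w * val x i)%g
    (asboolT (gromov_seqMl w (asboolW (valP x)))).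

Definition boundary_action w (a : gromov_boundary) : gromov_boundary :=
  boundary_class (gseq_mul w (repr a)).

Lemma limf_einf_pinftyP (T : topologicalType) (F : set_system T) (f : T -> R) :
  Filter F ->
  limf_einf (fun t => (f t)%:E) F = +oo%E <-> forall M, F [set t | M <= f t].
Proof.
move=> FF; rewrite limf_einfE; split=> [foo M|fM].
  have : (M%:E < ereal_sup [set ereal_inf ((fun t => (f t)%:E) @` V) | V in F])%E.
    by rewrite foo ltry.
  move=> /ereal_sup_gt[_ [V FV <-] /ltW MV].
  apply: filterS FV => t Vt /=; rewrite -lee_fin (le_trans MV)//.
  by apply: ereal_inf_lbound; exists t.
apply/eqyP => M _; apply: le_ereal_sup_tmp.
exists (ereal_inf ((fun t => (f t)%:E) @` [set t | M <= f t])).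
  by exists [set t | M <= f t] => //; exact: fM.
by apply: le_ereal_inf_tmp => _ [t /= Mt <-]; rewrite lee_fin.
Qed.

Lemma gsimMl w (x y : gseq) : gsim x y -> gsim (gseq_mul w x) (gseq_mul w y).
Proof.
move=> /limf_einf_pinftyP xy; apply/limf_einf_pinftyP => M.
apply: filterS (xy (M + (word_length w)%:R)) => p /=; rewrite -lerBrDr => /le_trans.
by apply; exact: gromov_productMl.
Qed.

Lemma gequivMl w (x y : gseq) :
  gequiv x y -> gequiv (gseq_mul w x) (gseq_mul w y).
Proof.
move=> /asboolP xy; apply/asboolP; elim: xy => [a b|a|a b _|a b c _ + _].
- by move=> /(gsimMl w); exact: rst_step.
- exact: rst_refl.
- exact: rst_sym.
- exact: rst_trans.
Qed.

Lemma boundary_actionE w (x : gseq) :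
  boundary_action w (boundary_class x) = boundary_class (gseq_mul w x).
Proof. by apply/eqmodP/gequivMl/eqmodP; rewrite reprK. Qed.

End GromovBoundary.

(* Main.v *)
(* Each orbit point is [w . o = w(o) / N w], where [N w = |w(o)|_1].  As [B] is
   positive definite on the orthogonal complement of [o], neighbours in the
   Cayley graph have orbit points at distance at most of order [1 / N].  Along
   a reduced word, [N] grows by the heights [|beta|_1] of the positive roots
   inverted by the word, and only polynomially many positive roots have height
   at most [T]: two distinct roots of height at most [T] are at distance at
   least of order [1 / T], since the dihedral group they generate would
   otherwise contain a root of height too close to [0].  Hence
   [N w >= c |w|^(1 + 1/(2n))], which is summable along word geodesics.  A
   geodesic from [g] to [h] stays outside the ball of radius [(g|h)], so the
   orbit points of [g] and [h] are uniformly close once [(g|h)] is large: this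
   is Floyd's argument, and it gives a well-defined continuous map [F].  It is
   onto because every sequence in [W] with infinitely many values has, by
   Koenig's lemma, a subsequence of elements with reduced words that share
   longer and longer prefixes. *)

Require Import Defs.
From mathcomp Require Import all_boot all_order all_algebra all_fingroup.
From mathcomp Require Import generic_quotient.
From mathcomp Require Import all_classical all_reals all_analysis.
From mathcomp Require Import finmap complex spectral sesquilinear ring lra zify.

Set Implicit Arguments.
Unset Strict Implicit.
Unset Printing Implicit Defensive.

Import Order.TTheory GRing.Theory Num.Theory.
Import numFieldNormedType.Exports.

Local Open Scope classical_set_scope.
Local Open Scope ring_scope.

(* [fingroup] also has a lemma called [norm1]. *)
Local Notation norm1 := Defs.norm1.

(** * Positivity of the form on the orthogonal complement of [o] *)

Lemma char_poly_conj (F : fieldType) n (P A : 'M[F]_n) :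
  P \in unitmx -> char_poly (invmx P *m A *m P) = char_poly A.
Proof.
move=> Pu; set Q := map_mx polyC P.
have eqA : char_poly_mx (invmx P *m A *m P) =
    map_mx polyC (invmx P) *m char_poly_mx A *m Q.
  rewrite /char_poly_mx !map_mxM mulmxBr mulmxBl; congr (_ - _).
  by rewrite mul_mx_scalar -scalemxAl -map_mxM mulVmx// map_mx1 scalemx1.
rewrite /char_poly eqA !det_mulmx mulrAC -det_mulmx -map_mxM mulVmx//.
by rewrite map_mx1 det1 mul1r.
Qed.

Section HyperbolicForm.
Variables (R : realType) (n : nat).
Implicit Types (B : 'M[R]_n) (u v o : 'cV[R]_n).

Local Open Scope complex_scope.
Local Open Scope sesquilinear_scope.

(** A unitary change of basis diagonalizes [B] over the complex numbers. Exactly one eigenvalue is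
    negative and [o] spans its line, so orthogonality to [o] kills that coordinate of [v] and only
    positive eigenvalues contribute. *)
Lemma signature_posdef B o v : B^T = B -> signature B n.-1 1 ->
  negative_direction B o -> norm1 o v = 0 -> v != 0 -> 0 < bform B v v.
Proof.
move=> Bsym [e Be [epos eneg]] [[la la0 Bo] osq opos] ov v0.
have n0 : (0 < n)%N.
  case: n o osq {opos Bo ov} => // o' /eqP.
  by rewrite big_ord0 eq_sym oner_eq0.
pose f := real_complex R : R -> R[i].
have fpos a : (0 < f a) = (0 < a) by rewrite -(ltcR 0 a).
have fneg a : (f a < 0) = (a < 0) by rewrite -(ltcR a 0).
pose A := map_mx f B.
have Areal : A \is a mxOver Num.real.
  by apply/mxOverP => i j; rewrite mxE complex_real.
have Asym : A \is symmetricmx.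
  apply/is_hermitianmxP; rewrite expr0 scale1r; apply/matrixP => i j.
  by rewrite !mxE/= -[in LHS]Bsym mxE.
have := realsym_hermsym Asym Areal => /hermitian_normalmx/orthomx_spectralP.
set P := spectralmx A; set d := spectral_diag A => Aeq.
have Pun : P \is unitarymx by exact: spectral_unitarymx.
have Pu := unitarymx_unit Pun.
have ed : perm_eq [seq d 0 i | i <- index_enum 'I_n] (map f e).
  apply: prod_XsubC_eq; rewrite !big_map.
  have -> : \prod_(j <- e) ('X - (f j)%:P) = map_poly f (char_poly B).
    by rewrite Be rmorph_prod; apply: eq_bigr => a _; rewrite /= map_polyXsubC.
  rewrite map_char_poly -/A Aeq char_poly_conj// char_poly_trig; last first.
    exact: diag_mx_is_trig.
  by apply: eq_bigr => i _; rewrite mxE eqxx.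
have dneg : count (fun a => a < 0) [seq d 0 i | i <- index_enum 'I_n] = 1%N.
  rewrite (seq.permP ed) count_map -eneg; apply: eq_count => a /=.
  by rewrite fneg.
have esz : size e = n.
  have := perm_size ed; rewrite !size_map => <-.
  by rewrite -[RHS]card_ord -sum1_card -sum1_size.
(* The [n - 1] positive and the one negative eigenvalue exhaust the [n] entries of [e], so none is
   zero. *)
have epn a : a \in e -> 0 < a \/ a < 0.
  have : all (predU (fun a => 0 < a) (fun a => a < 0)) e.
    rewrite all_count esz.
    have := count_predUI (fun a : R => 0 < a) (fun a => a < 0) e.
    rewrite epos eneg (@eq_count _ (predI _ _) pred0) ?count_pred0; last first.
      by move=> b /=; case: ltgtP.
    by rewrite addn0 addn1 prednK// => ->.
  by move=> /allP h /h/= /orP[]; [left|right].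
have dpn i : 0 < d 0 i \/ d 0 i < 0.
  have : d 0 i \in map f e.
    by rewrite -(perm_mem ed); apply/mapP; exists i; rewrite ?mem_index_enum.
  by case/mapP=> a /epn[] h ->; rewrite fpos fneg; [left|right].
pose y := P *m map_mx f o; pose x := P *m map_mx f v.
have PA (w : 'cV[R[i]]_n) i : (P *m (A *m w)) i 0 = d 0 i * (P *m w) i 0.
  rewrite Aeq !mulmxA mulmxV// mul1mx -mulmxA.
  by rewrite mul_diag_mx mxE.
have Ptf (u : 'cV[R]_n) : (map_mx f u)^t* = (map_mx f u)^T.
  by rewrite map_trmx; apply/matrixP => i j; rewrite !mxE; exact: conjc_real.
have dot (u : 'cV[R]_n) (w : 'cV[R[i]]_n) :
    ((map_mx f u)^T *m w) 0 0 = \sum_i ((P *m map_mx f u) i 0)^* * (P *m w) i 0.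
  rewrite -Ptf -[w in LHS]mul1mx -(mulVmx Pu) invmx_unitary//.
  rewrite !mulmxA -map_mxM -trmx_mul -mulmxA mxE.
  by apply: eq_bigr => i _; rewrite !mxE.
have yla i : d 0 i * y i 0 = f la * y i 0.
  rewrite -PA -map_mxM Bo; rewrite /y [map_mx f (_ *: _)]map_mxZ.
  by rewrite -scalemxAr mxE.
(* A nonzero coordinate of [o] in the eigenbasis forces the eigenvalue there to be [la]. *)
have [i0 yi0 di0] : exists2 i, y i 0 != 0 & d 0 i < 0.
  have : y != 0.
    apply/eqP => /(congr1 (mulmx (invmx P))); rewrite mulKmx// mulmx0.
    move=> /matrixP/(_ (Ordinal n0) 0); rewrite !mxE => /complexI o0.
    by have := opos (Ordinal n0); rewrite o0 ltxx.
  case/matrix0Pn => i [j]; rewrite ord1 => yi0; exists i => //.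
  by have /(mulIf yi0) -> := yla i; rewrite fneg.
have dpos i : i != i0 -> 0 < d 0 i.
  move=> ii0; have [//|di] := dpn i; exfalso.
  move: dneg; rewrite count_map -size_filter.
  have : [seq x <- index_enum 'I_n | preim (fun i : 'I_n => d 0 i) (fun a => a < 0) x]
     =i [pred i | d 0 i < 0].
    by move=> j; rewrite mem_filter mem_index_enum !inE andbT.
  set s := [seq _ <- _ | _] => si; have us : uniq s by rewrite filter_uniq ?index_enum_uniq.
  have si1 : i \in s by rewrite si inE.
  have si2 : i0 \in s by rewrite si inE.
  move: us si1 si2; case: s {si} => [|a [|b s]] //= _.
  by rewrite !inE => /eqP ia /eqP i0a _; move: ii0; rewrite ia i0a eqxx.
have y0 i : i != i0 -> y i 0 = 0.
  move=> /dpos di; have /eqP := yla i; rewrite -subr_eq0 -mulrBl mulf_eq0.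
  case/orP => /eqP // /eqP; rewrite subr_eq0 => /eqP dl.
  by move: di; rewrite dl fpos => /lt_trans/(_ la0); rewrite ltxx.
(* [norm1 o v] is the Euclidean product of [o] and [v], which the unitary [P] preserves; only the
   term at [i0] survives. *)
have x0 : x i0 0 = 0.
  have : (map_mx f o)^T *m map_mx f v = 0.
    rewrite map_trmx -map_mxM; apply/matrixP => i j; rewrite !ord1 !mxE.
    rewrite -[RHS]/(f 0) -[in RHS]ov; congr f.
    by apply: eq_bigr => k _; rewrite !mxE.
  move=> /matrixP/(_ 0 0); rewrite dot (bigD1 i0)//= big1 ?addr0; last first.
    by move=> i ii0; rewrite -/y y0// conjC0 mul0r.
  move/eqP; rewrite -/y -/x [X in _ == X]mxE mulf_eq0 conjC_eq0 (negbTE yi0).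
  by move=> /eqP.
suff : 0 < f (bform B v v) by rewrite fpos.
have -> : f (bform B v v) = \sum_i d 0 i * (x i 0 * (x i 0)^*).
  have -> : f (bform B v v) = ((map_mx f v)^T *m (A *m map_mx f v)) 0 0.
    by rewrite map_trmx -!map_mxM mulmxA mxE.
  rewrite dot; apply: eq_bigr => i _; rewrite PA -/x; ring.
have tge0 i : 0 <= d 0 i * (x i 0 * (x i 0)^*).
  have [->|/dpos di] := eqVneq i i0; first by rewrite x0 mul0r mulr0.
  by rewrite mulr_ge0 ?(ltW di) ?mul_conjC_ge0.
have [i1 xi1] : exists i, x i 0 != 0.
  have : x != 0.
    apply: contra v0 => /eqP /(congr1 (mulmx (invmx P))); rewrite mulKmx// mulmx0.
    move=> v0; apply/eqP/matrixP => i j; move: v0 => /matrixP/(_ i j).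
    by rewrite !mxE => /complexI.
  by case/matrix0Pn => i [j]; rewrite ord1 => ?; exists i.
rewrite (bigD1 i1)//= ltr_pwDl ?sumr_ge0// lt0r tge0 andbT mulf_neq0//.
  have /dpos : i1 != i0 by apply: contra xi1 => /eqP ->; rewrite x0.
  by move=> /lt0r_neq0.
by rewrite mulf_neq0 ?conjC_eq0.
Qed.

End HyperbolicForm.

(** * Word length and alternating products *)

Section WordLength.
Variables (n : nat) (m : coxeterMatrix n) (W : coxeterSystem m).
Implicit Types (i j : 'I_n) (u : seq 'I_n) (w g h : W).

Local Open Scope group_scope.

Local Notation gen := (cox_gen W).
Local Notation len := (@word_length n m W).

Definition word_prod u : W := \prod_(i <- u) gen i.

Lemma word_prod_cons i u : word_prod (i :: u) = gen i * word_prod u.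
Proof. by rewrite /word_prod big_cons. Qed.

Lemma word_prod_rcons u i : word_prod (rcons u i) = word_prod u * gen i.
Proof. by rewrite /word_prod -cats1 big_cat/= big_seq1. Qed.

Lemma word_prod_cat u v : word_prod (u ++ v) = word_prod u * word_prod v.
Proof. by rewrite /word_prod big_cat. Qed.

Lemma cox_genM i : gen i * gen i = 1.
Proof. by have := @cox_gen_rel _ _ W _ _ _ (cox_label_diag m i); rewrite expg1. Qed.

Lemma cox_genMr i : involutive (mulg^~ (gen i)).
Proof. by move=> w; rewrite -mulgA cox_genM mulg1. Qed.

Lemma cox_genV i : (gen i)^-1 = gen i.
Proof. by apply: (mulgI (gen i)); rewrite mulgV cox_genM. Qed.

Lemma word_length_le u : (len (word_prod u) <= size u)%N.
Proof.
rewrite /word_length; case: ex_minnP => k _; apply.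
by apply/existsP; exists (in_tuple u).
Qed.

Lemma reduced_word w : exists2 u, word_prod u = w & size u = len w.
Proof.
rewrite /word_length; case: ex_minnP => k /existsP[u /eqP uw] _.
by exists u => //; rewrite size_tuple.
Qed.

Lemma word_length1 : len 1 = 0%N.
Proof.
by have := word_length_le [::]; rewrite /word_prod big_nil leqn0 => /eqP.
Qed.

Lemma word_prod_rev u : word_prod (rev u) = (word_prod u)^-1.
Proof.
elim: u => [|i u IH]; first by rewrite /word_prod big_nil invg1.
by rewrite rev_cons word_prod_rcons IH word_prod_cons invgM cox_genV.
Qed.

Lemma word_lengthV w : len w^-1 = len w.
Proof.
suff le g : (len g^-1 <= len g)%N.
  by apply/eqP; rewrite eqn_leq le -{1}[w]invgK le.
have [u <- <-] := reduced_word g.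
by rewrite -word_prod_rev -(size_rev u) word_length_le.
Qed.

Lemma word_length_gen_le i : (len (gen i) <= 1)%N.
Proof. by have := word_length_le [:: i]; rewrite /word_prod big_seq1. Qed.

Lemma word_lengthMgen_le w i : (len (w * gen i) <= (len w).+1)%N.
Proof.
by rewrite (leq_trans (word_lengthM _ _))// -addn1 leq_add2l word_length_gen_le.
Qed.

Lemma word_length_leMgen w i : (len w <= (len (w * gen i)).+1)%N.
Proof. by have := word_lengthMgen_le (w * gen i) i; rewrite cox_genMr. Qed.

(** Sending every generator to the transposition of ['S_2] respects all relations and gives the sign
    character, so multiplying by a generator flips the parity of the length. *)
Lemma word_lengthMgen_neq w i : len (w * gen i) <> len w.
Proof.
pose t : 'S_2 := tperm ord0 ord_max.
have tt1 : t * t = 1 by exact: tperm2.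
have [|f fM fgen] := cox_gen_univ W (G := 'S_2) (g := fun=> t).
  by move=> a b k _; rewrite /= tt1 expg1n.
have flen g : f g = t ^+ len g.
  have [u <- <-] := reduced_word g; elim: u => [|j u IH] /=.
    apply: (mulgI (f (word_prod [::]))); rewrite -fM /word_prod big_nil !mulg1.
    by [].
  by rewrite word_prod_cons fM fgen IH expgS.
move=> eql; have := fM w (gen i); rewrite fgen !flen eql.
rewrite -[LHS]mulg1 => /mulgI /permP/(_ ord0).
by rewrite perm1 tpermL.
Qed.

Lemma word_lengthMgen w i :
  len (w * gen i) = (len w).+1 \/ len w = (len (w * gen i)).+1.
Proof.
have := word_lengthMgen_le w i; have := word_length_leMgen w i.
by have := @word_lengthMgen_neq w i; lia.
Qed.

(** * Alternating products of two generators *)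

Section Alternating.
Variables s t : 'I_n.

(** Letters are indexed from the right end: index 0 is the last factor [t], and [alt_letter k] is
    the factor that extends [alt_prod k] to [alt_prod k.+1]. *)
Definition alt_letter k := if odd k then s else t.

(* The alternating product of length [k] whose last factor is [t]. *)
Fixpoint alt_prod k : W :=
  if k is k'.+1 then gen (alt_letter k') * alt_prod k' else 1.

Lemma alt_prod_split k l : (l <= k)%N ->
  exists2 u, size u = (k - l)%N & alt_prod k = word_prod u * alt_prod l.
Proof.
elim: k => [|k IH]; first by case: l => // _; exists [::]; rewrite ?/word_prod ?big_nil ?mul1g.
rewrite leq_eqVlt => /predU1P[->|]; last rewrite ltnS => lk.
  by exists [::]; rewrite ?subnn// /word_prod big_nil mul1g.
have [u su uk] := IH lk; exists (alt_letter k :: u).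
  by rewrite /= su subSn.
by rewrite word_prod_cons -mulgA -uk.
Qed.

End Alternating.

Lemma alt_prod_last s t k : alt_prod s t k.+1 = alt_prod t s k * gen t.
Proof.
elim: k => [|k IH]; first by rewrite /= mulg1 mul1g.
rewrite [LHS]/= -/(alt_prod s t k.+1) IH mulgA; congr (_ * _).
by rewrite /= /alt_letter/=; case: (odd k).
Qed.

(** Inversion turns the product ending in [s] into one starting with [s], so both halves join to
    [2k] letters alternating from [s]. This translates the Coxeter relation into the braid
    relation. *)
Lemma alt_prodV s t k : (alt_prod t s k)^-1 * alt_prod s t k = (gen s * gen t) ^+ k.
Proof.
elim: k s t => [|k IH] s t; first by rewrite /= invg1 mulg1.
rewrite !alt_prod_last invgM cox_genV -mulgA (mulgA _ _ (gen t)) IH.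
elim: k {IH} => [|k IH]; first by rewrite expg0 mul1g expg1.
by rewrite [in LHS]expgS [in RHS]expgS -IH !mulgA.
Qed.

Lemma alt_prod_braid s t k : m s t = Some k -> alt_prod s t k = alt_prod t s k.
Proof.
move=> mst; apply: (mulgI (alt_prod t s k)^-1).
by rewrite mulVg alt_prodV (@cox_gen_rel _ _ W _ _ _ mst).
Qed.

End WordLength.

(** * The geometric representation and positivity of roots *)

Section FormAlgebra.
Variables (R : realType) (n : nat) (B : 'M[R]_n).
Implicit Types (a : R) (u v w : 'cV[R]_n).

Lemma bformDl u v w : bform B (u + v) w = bform B u w + bform B v w.
Proof. by rewrite /bform linearD/= !mulmxDl mxE. Qed.

Lemma bformDr u v w : bform B w (u + v) = bform B w u + bform B w v.
Proof. by rewrite /bform mulmxDr mxE. Qed.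

Lemma bformZl a u v : bform B (a *: u) v = a * bform B u v.
Proof. by rewrite /bform linearZ/= -!scalemxAl mxE. Qed.

Lemma bformZr a u v : bform B u (a *: v) = a * bform B u v.
Proof. by rewrite /bform -scalemxAr mxE. Qed.

Lemma bformNl u v : bform B (- u) v = - bform B u v.
Proof. by rewrite -scaleN1r bformZl mulN1r. Qed.

Lemma bformNr u v : bform B u (- v) = - bform B u v.
Proof. by rewrite -scaleN1r bformZr mulN1r. Qed.

Lemma bform_alpha i j : bform B (alpha R i) (alpha R j) = B i j.
Proof. by rewrite /bform /alpha trmx_delta -rowE -colE !mxE. Qed.

Lemma bformC u v : B^T = B -> bform B u v = bform B v u.
Proof.
move=> Bsym; rewrite /bform.
have -> : u^T *m B *m v = (v^T *m B *m u)^T by rewrite !trmx_mul trmxK Bsym mulmxA.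
by rewrite mxE.
Qed.

Definition bformE := (bformDl, bformDr, bformNl, bformNr, bformZl, bformZr).

End FormAlgebra.

(** * Chebyshev values and their signs *)

Section Chebyshev.
Variable R : realType.
Implicit Types (c : R) (k : nat).

(* Chebyshev polynomials of the second kind, shifted by one: the value is
   [sin (k theta) / sin theta] at [c = cos theta]. *)
Definition cheb c k : R := (iter k (fun p => (p.2, 2 * c * p.2 - p.1)) (0, 1)).1.

Lemma chebSS c k : cheb c k.+2 = 2 * c * cheb c k.+1 - cheb c k.
Proof. by []. Qed.

Lemma cheb_cos (x : R) k : cheb (cos x) k * sin x = sin (k%:R * x).
Proof.
suff: cheb (cos x) k * sin x = sin (k%:R * x) /\
      cheb (cos x) k.+1 * sin x = sin (k.+1%:R * x) by case.
elim: k => [|k [IH1 IH2]].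
  by rewrite /cheb/= !mul0r sin0 !mul1r.
split=> //; rewrite chebSS.
have -> : (2 * cos x * cheb (cos x) k.+1 - cheb (cos x) k) * sin x =
  2 * cos x * (cheb (cos x) k.+1 * sin x) - cheb (cos x) k * sin x by ring.
rewrite IH2 IH1.
have -> : k%:R * x = k.+1%:R * x - x by rewrite -natr1; ring.
have -> : k.+2%:R * x = k.+1%:R * x + x by rewrite -[k.+2%:R]natr1; ring.
by rewrite sinB sinD; ring.
Qed.

(** The angle [k pi / N] stays in [[0, pi]], where the sine is nonnegative. *)
Lemma cheb_ge0_cos N k : (1 < N)%N -> (k <= N)%N -> 0 <= cheb (cos (pi / N%:R) : R) k.
Proof.
move=> N1 kN; have N0 : 0 < N%:R :> R by rewrite ltr0n; lia.
have sx : 0 < sin (pi / N%:R : R).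
  apply: sin_gt0_pi; rewrite divr_gt0 ?pi_gt0//= ltr_pdivrMr//.
  by rewrite ltr_pMr ?pi_gt0// ltr1n.
rewrite -(pmulr_lge0 _ sx) cheb_cos; apply: sin_ge0_pi.
rewrite mulr_ge0 ?divr_ge0 ?pi_ge0//= mulrCA ger_pMr ?pi_gt0//.
by rewrite ler_pdivrMr// mul1r ler_nat.
Qed.

(** For [c >= 1] the sequence starts at 0 and is nondecreasing; the induction has to carry the
    monotonicity. *)
Lemma cheb_ge0 c k : 1 <= c -> 0 <= cheb c k.
Proof.
move=> c1; suff: 0 <= cheb c k /\ cheb c k <= cheb c k.+1 by case.
elim: k => [|k [IH1 IH2]]; first by rewrite /cheb/= lexx ler01.
split; first exact: le_trans IH1 IH2.
by rewrite chebSS; nra.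
Qed.

End Chebyshev.

Section GeometricRepresentation.
Variables (R : realType) (n : nat) (m : coxeterMatrix n) (W : coxeterSystem m).
Variables (B : 'M[R]_n) (rho : W -> 'M[R]_n).
Hypotheses (Bcox : coxeter_form m B) (rhoB : geometric_action B rho).
Implicit Types (i j s t : 'I_n) (u v : 'cV[R]_n) (w g : W).

Local Notation gen := (cox_gen W).
Local Notation len := (@word_length n m W).
Local Notation al := (alpha R).

Lemma bform_sym u v : bform B u v = bform B v u.
Proof. by apply: bformC; case: Bcox. Qed.

Lemma bform_simple i : bform B (al i) (al i) = 1.
Proof.
rewrite bform_alpha; have [_ /(_ i i)] := Bcox; rewrite cox_label_diag => ->.
by rewrite divr1 cospi opprK.
Qed.

Lemma rho1 : rho 1%g = 1%:M. Proof. by case: rhoB. Qed.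

Lemma rhoM w g : rho (w * g)%g = rho w *m rho g. Proof. by case: rhoB. Qed.

Lemma rho_gen i v : rho (gen i) *m v = v - (2 * bform B (al i) v) *: al i.
Proof. by case: rhoB. Qed.

Lemma rhoVK w v : rho w^-1%g *m (rho w *m v) = v.
Proof. by rewrite mulmxA -rhoM mulVg rho1 mul1mx. Qed.

Lemma rho_simple i : rho (gen i) *m al i = - al i.
Proof.
rewrite rho_gen bform_simple mulr1 scaler_nat mulr2n opprD addrA subrr.
by rewrite add0r.
Qed.

Lemma bform_rho w u v : bform B (rho w *m u) (rho w *m v) = bform B u v.
Proof.
have [x <- _] := reduced_word w; elim: x => [|i x IH] in u v *.
  by rewrite /word_prod big_nil rho1 !mul1mx.
rewrite word_prod_cons rhoM -!mulmxA !rho_gen !bformE bform_simple.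
rewrite (bform_sym (_ *m _) (al i)) IH; ring.
Qed.

Definition nonneg v := forall i, 0 <= v i 0.

Lemma nonnegD u v : nonneg u -> nonneg v -> nonneg (u + v).
Proof. by move=> u0 v0 i; rewrite mxE addr_ge0. Qed.

Lemma nonnegZ (a : R) v : 0 <= a -> nonneg v -> nonneg (a *: v).
Proof. by move=> a0 v0 i; rewrite mxE mulr_ge0. Qed.

Lemma nonneg_simple i : nonneg (al i).
Proof. by move=> j; rewrite mxE ler0n. Qed.

Lemma alt_letterSS s t k : alt_letter s t k.+2 = alt_letter s t k.
Proof. by rewrite /alt_letter /= negbK. Qed.

(** In the plane of the two simple roots, each further reflection is one step of the Chebyshev
    recurrence. Positivity of roots of the dihedral subgroup thus becomes positivity of [cheb]. *)
Lemma rho_alt_prod s t k :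
  rho (alt_prod W s t k) *m al s =
  cheb (- B s t) k.+1 *: al (alt_letter s t k.+1) +
  cheb (- B s t) k *: al (alt_letter s t k).
Proof.
elim: k => [|k IH].
  by rewrite /= rho1 mul1mx /cheb/= scale0r scale1r addr0.
rewrite [alt_prod _ _ _ _]/= rhoM -mulmxA IH mulmxDr -!scalemxAr rho_simple.
rewrite rho_gen bform_alpha chebSS alt_letterSS.
have -> : B (alt_letter s t k) (alt_letter s t k.+1) = B s t.
  rewrite /alt_letter/=; case: (odd k) => //=.
  by rewrite -!bform_alpha bform_sym.
rewrite scalerBr scalerBl !scalerA scalerN -addrA addrC; congr (_ + _).
rewrite -scaleNr -scalerBl -scaleNr -scalerDl; congr (_ *: _); ring.
Qed.

(* Split [w = v a] with [a] the longest alternating product in [s], [t] that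
   is a reduced suffix of [w]: then [v] lengthens under both [s] and [t], so
   the induction hypothesis applies to it. *)
Theorem simple_root_nonneg w s :
  len (w * gen s)%g = (len w).+1 -> nonneg (rho w *m al s).
Proof.
have [N] := ubnP (len w); elim: N w s => // N IH w s wN ws.
have [u uw usz] := reduced_word w.
case/lastP: u => [|u t] in uw usz *.
  rewrite -uw /word_prod big_nil rho1 mul1mx; exact: nonneg_simple.
have wt : (len (w * gen t)%g < len w)%N.
  rewrite -usz size_rcons ltnS -uw word_prod_rcons cox_genMr.
  exact: word_length_le.
have st : s != t by apply/eqP => st; move: ws wt; rewrite st => ->; lia.
(* [P k] says that the alternating product of length [k] is a reduced suffix of [w]. *)
pose P k := (len (w * (alt_prod W s t k)^-1)%g + k == len w)%N.
have P1 : P 1%N.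
  rewrite /P /= mulg1 /alt_letter/= cox_genV addn1.
  by have := word_length_leMgen w t; lia.
have Pub k : P k -> (k <= len w)%N by rewrite /P => /eqP <-; exact: leq_addl.
case: (ex_maxnP (ex_intro P 1%N P1) Pub) => k /eqP Pk kmax.
have k1 : (1 <= k)%N by exact: kmax.
have [v Pv wv] : exists2 v, (len v + k)%N = len w & w = (v * alt_prod W s t k)%g.
  by exists (w * (alt_prod W s t k)^-1)%g; rewrite ?mulgVK.
(* Otherwise [v] could give up one more letter and the suffix would not be the longest. *)
have vx : len (v * gen (alt_letter s t k))%g = (len v).+1.
  have [//|vl] := word_lengthMgen v (alt_letter s t k).
  have /kmax : P k.+1.
    by rewrite /P /= invgM cox_genV mulgA {1}wv mulgK addnS -addSn -vl Pv.
  by rewrite ltnn.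
(* This letter is the first factor of the alternating suffix; if it shortened [v], moving it across
   would write [w] with fewer than [len w] letters. *)
have vy : len (v * gen (alt_letter s t k.+1))%g = (len v).+1.
  have [//|vl] := word_lengthMgen v (alt_letter s t k.+1).
  have : (len w <= len (v * gen (alt_letter s t k.+1))%g + k.-1)%N.
    rewrite wv; case: k k1 {Pk Pv kmax vx vl} wv => // k _ _.
    rewrite alt_letterSS /= mulgA; apply: leq_trans (word_lengthM _ _) _.
    rewrite leq_add2l; have [x xk ->] := alt_prod_split W s t (leq0n k).
    by rewrite /= mulg1 -(subn0 k) -xk word_length_le.
  lia.
have lv : (len v < N)%N by lia.
rewrite wv rhoM -mulmxA rho_alt_prod mulmxDr -!scalemxAr.
suff cheb0 l : (k <= l <= k.+1)%N -> 0 <= cheb (- B s t) l.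
  by apply: nonnegD; apply: nonnegZ; [apply: cheb0; lia|exact: IH| apply: cheb0; lia|exact: IH].
move=> kl; have [_ /(_ s t)] := Bcox; case mst : (m s t) => [M|]; last first.
  by move=> Bst; apply: cheb_ge0; lra.
move=> ->; rewrite opprK; apply: cheb_ge0_cos; first exact: cox_label_ge2 st mst.
apply: leq_trans (_ : k.+1 <= _)%N; first by case/andP: kl.
(* If [M <= k], the suffix contains a braid of length [M], which can be rewritten to end in [s];
   then [s] would shorten [w]. *)
rewrite ltnNge; apply/negP => Mk.
have M1 := cox_label_ge2 st mst.
have [x xk ak] := alt_prod_split W s t Mk.
have : (len (w * gen s)%g <= len v + (size x + M.-1))%N.
  rewrite wv ak (alt_prod_braid W mst); case: M M1 {mst Mk xk ak kl} => // M _.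
  rewrite alt_prod_last -!mulgA cox_genM mulg1 mulgA addnA.
  apply: leq_trans (word_lengthM _ _) _; apply: leq_add.
    by apply: leq_trans (word_lengthM _ _) _; rewrite leq_add2l word_length_le.
  have [y yk ->] := alt_prod_split W s t (leq0n M).
  by rewrite /= mulg1 -(subn0 M) -yk word_length_le.
lia.
Qed.

End GeometricRepresentation.

(** * Heights and separation of roots *)

(* Here [b] is the value of the form on two roots and [h] the sequence of
   heights of the roots they generate; the quantity
   [h_k^2 + h_(k+1)^2 - 2 b h_k h_(k+1)] does not depend on [k].  A sequence
   of constant sign would be strictly log-concave, and hence come close to
   [0], so the sign changes somewhere. *)
Lemma recurrence_sign_change (R : realType) (b c E : R) (h : nat -> R) :
  0 <= b -> 0 < c -> 0 < E ->
  (forall k, h k.+2 = 2 * b * h k.+1 - h k) -> (forall k, c <= `|h k|) ->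
  0 < h 1%N -> h 1%N <= h 0%N ->
  h 0%N ^+ 2 + h 1%N ^+ 2 - 2 * b * (h 0%N * h 1%N) = E -> 2 * c ^+ 2 <= E.
Proof.
move=> b0 c0 E0 hS hc h1 h10 hE0.
have hE k : h k ^+ 2 + h k.+1 ^+ 2 - 2 * b * (h k * h k.+1) = E.
  by elim: k => // k <-; rewrite hS; ring.
(* At a sign change the mixed term of the invariant is nonnegative, so [E] is at least the sum of
   two squares, each at least [c ^+ 2]. *)
have [[k hk]|hpos] := pselect (exists k, h k * h k.+1 <= 0).
  rewrite -(hE k).
  have sq x : c <= `|x| -> c ^+ 2 <= x ^+ 2.
    by move=> cx; rewrite -(real_normK (num_real x)) ler_pXn2r// nnegrE ltW.
  by have := sq _ (hc k); have := sq _ (hc k.+1); nra.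
have {}hpos k : 0 < h k.
  elim: k => [|k IH]; first exact: lt_le_trans h10.
  rewrite ltNge; apply/negP => hk; apply: hpos; exists k; nra.
have {}hc k : c <= h k by have := hc k; rewrite gtr0_norm.
have logc k : h k * h k.+2 < h k.+1 ^+ 2 by have := hE k; rewrite hS; nra.
have h21 : h 2%N < h 1%N.
  have : h 1%N * h 2%N < h 1%N * h 1%N.
    by apply: le_lt_trans (logc 0%N); rewrite ler_wpM2r// ltW.
  by rewrite ltr_pM2l.
(* Log-concavity bounds all later ratios by [r < 1]. Since [h] stays above [c], each step then loses
   at least [(1 - r) * c]. *)
pose r := h 2%N / h 1%N.
have r1 : r < 1 by rewrite ltr_pdivrMr// mul1r.
have hr k : h k.+2 <= r * h k.+1.
  elim: k => [|k IH]; first by rewrite /r divfK// gt_eqF.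
  have : h k.+1 * h k.+3 <= h k.+1 * (r * h k.+2).
    apply: le_trans (ltW (logc k.+1)) _.
    by rewrite mulrA [_ * r]mulrC expr2 ler_wpM2r// ltW.
  by rewrite ler_pM2l.
have dec k : h k.+1 <= h 1%N - k%:R * ((1 - r) * c).
  elim: k => [|k IH]; first by rewrite mul0r subr0.
  by have := hr k; have := hc k.+1; rewrite -natr1; nra.
have q0 : 0 < (1 - r) * c by rewrite mulr_gt0// subr_gt0.
(* At this index the linear bound [dec] has become negative, against [hpos]. *)
have := dec (Num.truncn (h 1%N / ((1 - r) * c))).+1.
have := truncnS_gt (h 1%N / ((1 - r) * c)); rewrite ltr_pdivrMr//.
set k := (Num.truncn _).+1; have := hpos k.+1; lra.
Qed.

Section Roots.
Variables (R : realType) (n : nat) (m : coxeterMatrix n) (W : coxeterSystem m).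
Variables (B : 'M[R]_n) (rho : W -> 'M[R]_n) (o : 'cV[R]_n).
Hypotheses (Bcox : coxeter_form m B) (rhoB : geometric_action B rho).
Hypotheses (Bsig : signature B n.-1 1) (oneg : negative_direction B o).
Implicit Types (i j s t : 'I_n) (u v : 'cV[R]_n) (w g : W).

Local Notation gen := (cox_gen W).
Local Notation len := (@word_length n m W).
Local Notation al := (alpha R).
Local Notation h := (norm1 o).

Lemma norm1D u v : h (u + v) = h u + h v.
Proof.
by rewrite /Defs.norm1 -big_split; apply: eq_bigr => i _; rewrite mxE mulrDr.
Qed.

Lemma norm1Z a v : h (a *: v) = a * h v.
Proof.
rewrite /Defs.norm1 mulr_sumr; apply: eq_bigr => i _; rewrite mxE; ring.
Qed.

Lemma norm1N v : h (- v) = - h v.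
Proof. by rewrite -scaleN1r norm1Z mulN1r. Qed.

Lemma norm1_alpha i : h (al i) = o i 0.
Proof.
rewrite /Defs.norm1 (bigD1 i)//= big1 => [|j ji]; rewrite !mxE ?eqxx.
  by rewrite mulr1 addr0.
by rewrite (negbTE ji) mulr0.
Qed.

Lemma o_gt0 i : 0 < o i 0. Proof. by case: oneg. Qed.

Lemma norm1_o : h o = 1.
Proof.
by case: oneg => _ <- _; rewrite /Defs.norm1; apply: eq_bigr => i _; rewrite expr2.
Qed.

Lemma bform_o : exists2 la, la < 0 & forall v, bform B o v = la * h v.
Proof.
case: oneg => -[la la0 Bo] _ _; exists la => // v.
have [Bsym _] := Bcox.
rewrite /bform -[B]Bsym -trmx_mul Bo linearZ/= -scalemxAl mxE; congr (_ * _).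
by rewrite mxE; apply: eq_bigr => i _; rewrite mxE.
Qed.

Lemma posdef v : h v = 0 -> v != 0 -> 0 < bform B v v.
Proof. by have [Bsym _] := Bcox; exact: signature_posdef. Qed.

Lemma posdef_ge0 v : h v = 0 -> 0 <= bform B v v.
Proof.
have [->|v0 hv] := eqVneq v 0; last by rewrite ltW ?posdef.
by rewrite /bform mulmx0 mxE.
Qed.

Lemma bform_bound : exists2 K, 0 < K & forall (u v : 'cV[R]_n) (x y : R),
  (forall i, `|u i 0| <= x) -> (forall i, `|v i 0| <= y) -> 
  0 <= x -> 0 <= y -> `|bform B u v| <= K * (x * y).
Proof.
exists (1 + \sum_j \sum_i `|B i j|).
  by rewrite ltr_pwDl// sumr_ge0// => j _; rewrite sumr_ge0.
move=> u v x y ux vy x0 y0; rewrite mulrDl mul1r ler_wpDl ?mulr_ge0//.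
rewrite /bform mxE mulr_suml; apply: le_trans (ler_norm_sum _ _ _) _.
apply: ler_sum => j _; rewrite normrM mxE mulr_suml.
apply: le_trans (_ : (\sum_i `|B i j| * x) * y <= _).
  rewrite ler_pM//; apply: le_trans (ler_norm_sum _ _ _) _.
  by apply: ler_sum => i _; rewrite normrM mxE mulrC ler_wpM2l.
by rewrite mulr_suml; apply: ler_sum => i _; rewrite mulrA.
Qed.

(** All weights [o i 0] are positive, so for a nonnegative vector no term of the height exceeds the
    whole; the height controls the size of positive roots. *)
Lemma nonneg_coord : exists2 L, 0 < L & forall v i, nonneg v -> v i 0 <= L * h v.
Proof.
exists (1 + \sum_i (o i 0)^-1).
  by rewrite ltr_pwDl// sumr_ge0// => j _; rewrite invr_ge0 ltW// o_gt0.
move=> v i v0.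
have hv j : o j 0 * v j 0 <= h v.
  rewrite /Defs.norm1 (bigD1 j)//= lerDl sumr_ge0// => k _.
  by rewrite mulr_ge0// ltW// o_gt0.
have hv0 : 0 <= h v by rewrite /Defs.norm1 sumr_ge0// => k _; rewrite mulr_ge0// ltW// o_gt0.
apply: le_trans (_ : (o i 0)^-1 * h v <= _).
  by rewrite mulrC ler_pdivlMr ?o_gt0// mulrC.
rewrite ler_wpM2r// (bigD1 i)//= addrCA lerDl addr_ge0// sumr_ge0// => j _.
by rewrite invr_ge0 ltW// o_gt0.
Qed.

Definition is_root v := exists w i, v = rho w *m al i.

Lemma rootN v : is_root v -> is_root (- v).
Proof.
move=> [w [i ->]]; exists (w * gen i)%g, i.
by rewrite (rhoM rhoB) -mulmxA (rho_simple Bcox rhoB) mulmxN.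
Qed.

Lemma root_bform v : is_root v -> bform B v v = 1.
Proof. by move=> [w [i ->]]; rewrite (bform_rho Bcox rhoB) (bform_simple Bcox). Qed.

Lemma root_reflection u v : is_root u -> is_root v -> is_root (v - (2 * bform B u v) *: u).
Proof.
move=> [w [i ->]] [g [j ->]]; exists (w * gen i * w^-1 * g)%g, j.
set x := rho g *m al j.
have wK : rho w *m (rho w^-1%g *m x) = x.
  by rewrite mulmxA -(rhoM rhoB) mulgV (rho1 rhoB) mul1mx.
rewrite !(rhoM rhoB) -!mulmxA (rho_gen rhoB) mulmxBr -scalemxAr -/x wK.
by rewrite -(bform_rho Bcox rhoB w (al i)) wK.
Qed.

(** If [w] is shortened by [s_i], then [w s_i] is lengthened by it and sends [alpha i] to the
    opposite root. *)
Lemma root_sign v : is_root v -> nonneg v \/ nonneg (- v).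
Proof.
move=> [w [i ->]]; have [l|l] := word_lengthMgen w i.
  by left; exact: (simple_root_nonneg Bcox rhoB).
right; rewrite -mulmxN -(rho_simple Bcox rhoB) mulmxA -(rhoM rhoB).
by apply: (simple_root_nonneg Bcox rhoB); rewrite cox_genMr.
Qed.

(** A positive root has form value 1, yet that value is at most [K * L ^+ 2] times the squared
    height, so the height cannot be too small. *)
Lemma root_norm1 : exists2 c, 0 < c & forall v, is_root v -> c <= `|h v|.
Proof.
have [K K0 KB] := bform_bound; have [L L0 Lh] := nonneg_coord.
have D0 : 0 < 1 + K * L ^+ 2 by rewrite ltr_pwDl ?mulr_ge0 ?sqr_ge0// ltW.
exists (1 + K * L ^+ 2)^-1; first by rewrite invr_gt0.
have key v : is_root v -> nonneg v -> (1 + K * L ^+ 2)^-1 <= h v.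
  move=> rv v0; have hv0 : 0 <= h v.
    by rewrite /Defs.norm1 sumr_ge0// => k _; rewrite mulr_ge0// ltW// o_gt0.
  have : `|bform B v v| <= K * ((L * h v) * (L * h v)).
    by apply: KB => // [i|i||]; rewrite ?ger0_norm ?Lh ?mulr_ge0// ltW.
  rewrite root_bform// normr1 => h1.
  rewrite -[X in X <= _]mul1r ler_pdivrMr//.
  rewrite leNgt; apply/negP => h2; move: h1; rewrite leNgt => /negP; apply.
  have L2 : 0 < K * L ^+ 2 by rewrite mulr_gt0 ?exprn_gt0.
  set z := h v in hv0 h2 *; set q := K * L ^+ 2 in D0 h2 L2.
  have -> : K * (L * z * (L * z)) = q * z * z by rewrite /q; ring.
  nra.
move=> v rv; have [v0|v0] := root_sign rv.
  by rewrite (le_trans (key _ rv v0))// ler_norm.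
by rewrite -normrN -norm1N (le_trans (key _ (rootN rv) v0))// ler_norm.
Qed.

Lemma root_nonneg_gt0 v : is_root v -> nonneg v -> 0 < h v.
Proof.
have [c c0 /(_ v) ch] := root_norm1; move=> /ch cv v0.
rewrite lt0r /Defs.norm1 sumr_ge0 ?andbT => [|k _].
  by rewrite -normr_gt0 (lt_le_trans c0).
by rewrite mulr_ge0// ltW// o_gt0.
Qed.

(** * The sequence of roots generated by two roots *)

Section Pencil.
Variables (u v : 'cV[R]_n).
Hypotheses (ru : is_root u) (rv : is_root v).

Let b := bform B u v.

Let chain k := iter k (fun p => (p.2, (2 * b) *: p.2 - p.1)) (u, v).

(** [chain] stores consecutive terms of a sequence starting with [u], [v]. Each new term is minus
    the reflection of the term two places earlier in the term just before it, hence a root. *)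
Lemma pencil_root k : [/\ is_root (chain k).1, is_root (chain k).2 &
  bform B (chain k).1 (chain k).2 = b].
Proof.
elim: k => [//|k]; rewrite /chain iterS -/(chain k).
case: (chain k) => x y /= [rx ry bxy]; split => //.
  have -> : (2 * b) *: y - x = - (x - (2 * bform B y x) *: y).
    by rewrite (bform_sym Bcox) bxy opprB.
  by apply/rootN/root_reflection.
by rewrite !bformE root_bform// (bform_sym Bcox y x) bxy; ring.
Qed.

(** The right-hand side is the invariant [E] of the heights along the chain. It equals the form at
    [h v *: u - h u *: v], a nonzero vector of height 0, so it is positive and
    [recurrence_sign_change] applies. *)
Lemma pencil_gap c : 0 < c -> (forall v, is_root v -> c <= `|h v|) ->
  nonneg u -> nonneg v -> u <> v -> 0 <= b -> h v <= h u ->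
  2 * c ^+ 2 <= (h u - h v) ^+ 2 + bform B (u - v) (u - v) * (h u * h v).
Proof.
move=> c0 hc u0 v0 uv b0 vu.
have hu := root_nonneg_gt0 ru u0; have hv := root_nonneg_gt0 rv v0.
have -> : (h u - h v) ^+ 2 + bform B (u - v) (u - v) * (h u * h v) =
    h u ^+ 2 + h v ^+ 2 - 2 * b * (h u * h v).
  rewrite !bformE !root_bform// (bform_sym Bcox v u) -/b; ring.
apply: (@recurrence_sign_change _ b _ _ (fun k => h (chain k).1)) => //=.
- have -> : h u ^+ 2 + h v ^+ 2 - 2 * b * (h u * h v) =
      bform B (h v *: u - h u *: v) (h v *: u - h u *: v).
    by rewrite !bformE !root_bform// (bform_sym Bcox v u) -/b; ring.
  apply: posdef; first by rewrite norm1D norm1N !norm1Z mulrC subrr.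
  rewrite subr_eq0; apply/eqP => e; apply: uv.
  have : bform B (h v *: u) (h v *: u) = bform B (h u *: v) (h u *: v) by rewrite e.
  rewrite !bformE !root_bform// !mulr1 -!expr2 => /eqP.
  rewrite eqrXn2 ?ltW// => /eqP huv; move: e; rewrite huv => /scalerI; apply.
  by rewrite gt_eqF.
- by move=> k; rewrite norm1D norm1N norm1Z.
- by move=> k; have [? _ _] := pencil_root k; exact: hc.
Qed.

End Pencil.

(** If the form is negative on the pair, then the form at [u - v] exceeds 2 and [u], [v] are far
    apart outright. Otherwise [pencil_gap] applies, and both of its terms are at most of order
    [(e * T) ^+ 2]. *)
Lemma root_separation : exists2 C, 0 < C & forall u v (e T : R),
  is_root u -> is_root v -> nonneg u -> nonneg v -> u <> v ->
  1 <= T -> h u <= T -> h v <= T -> 0 <= e ->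
  (forall i, `|u i 0 - v i 0| <= e) -> 1 <= C * (e * T) ^+ 2.
Proof.
have [K K0 KB] := bform_bound; have [c c0 hc] := root_norm1.
(* [S] bounds the height difference by [S * e]. In the final constant, [A] serves the nonnegative
   case and [K] the negative one. *)
pose S := \sum_i o i 0; pose A := (S ^+ 2 + K) / (2 * c ^+ 2).
have S0 : 0 <= S by rewrite sumr_ge0// => i _; rewrite ltW// o_gt0.
have A0 : 0 < A by rewrite divr_gt0 ?mulr_gt0 ?exprn_gt0// ltr_wpDl ?sqr_ge0.
exists (A + K); first by rewrite addr_gt0.
suff key u v e T : is_root u -> is_root v -> nonneg u -> nonneg v -> u <> v ->
    1 <= T -> h u <= T -> h v <= T -> 0 <= e -> h v <= h u ->
    (forall i, `|u i 0 - v i 0| <= e) -> 1 <= (A + K) * (e * T) ^+ 2.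
  move=> u v e T ru rv u0 v0 uv T1 uT vT e0 uve.
  have [vu|/ltW vu] := leP (h v) (h u); first exact: (key u v).
  apply: (key v u) => //; first by move=> /esym.
  by move=> i; rewrite distrC.
move=> ru rv u0 v0 uv T1 uT vT e0 vu uve.
have hu := root_nonneg_gt0 ru u0; have hv := root_nonneg_gt0 rv v0.
have Buv : bform B (u - v) (u - v) <= K * e ^+ 2.
  apply: le_trans (ler_norm _) _; rewrite expr2; apply: KB => // i.
    by rewrite !mxE uve.
  by rewrite !mxE uve.
have e2T : e ^+ 2 <= (e * T) ^+ 2.
  by rewrite exprMn ler_peMr ?sqr_ge0// expr_ge1// (le_trans ler01).
have [b0|b0] := leP 0 (bform B u v); last first.
  move: Buv; rewrite !bformE !root_bform// (bform_sym Bcox v u) => Buv.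
  have : 1 <= K * (e * T) ^+ 2.
    by apply: le_trans (_ : K * e ^+ 2 <= _); [lra|rewrite ler_wpM2l// ltW].
  have : 0 <= A * (e * T) ^+ 2 by rewrite mulr_ge0 ?sqr_ge0// ltW.
  by rewrite mulrDl; lra.
have := pencil_gap ru rv c0 hc u0 v0 uv b0 vu.
have huv : (h u - h v) ^+ 2 <= S ^+ 2 * e ^+ 2.
  rewrite -exprMn -[leLHS](real_normK (num_real _)) ler_pXn2r ?nnegrE ?mulr_ge0//.
  rewrite -norm1N -norm1D /Defs.norm1 mulr_suml.
  apply: le_trans (ler_norm_sum _ _ _) _; apply: ler_sum => i _.
  by rewrite normrM (gtr0_norm (o_gt0 i)) ler_wpM2l ?(ltW (o_gt0 i))// !mxE uve.
have Bh : bform B (u - v) (u - v) * (h u * h v) <= K * e ^+ 2 * T ^+ 2.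
  apply: le_trans (_ : K * e ^+ 2 * (h u * h v) <= _).
    by rewrite ler_wpM2r// mulr_ge0// ltW.
  by rewrite ler_wpM2l ?mulr_ge0 ?sqr_ge0 ?(ltW K0)// expr2 ler_pM// ltW.
move=> gap.
have : 2 * c ^+ 2 <= (S ^+ 2 + K) * (e * T) ^+ 2.
  apply: le_trans gap _; rewrite mulrDl lerD//.
    by apply: le_trans huv _; rewrite ler_wpM2l ?sqr_ge0.
  by rewrite exprMn [leRHS]mulrA.
have cc : 0 < 2 * c ^+ 2 by rewrite mulr_gt0 ?exprn_gt0.
move=> {}gap; apply: le_trans (_ : A * (e * T) ^+ 2 <= _).
  by rewrite /A mulrAC ler_pdivlMr// mul1r.
by rewrite mulrDl lerDl mulr_ge0 ?sqr_ge0// ltW.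
Qed.

(** Pigeonhole on cells of side [1 / (D t)]: two distinct roots in one cell would contradict
    [root_separation], because [C / D ^ 2 < 1]. Coordinates are at most [L t], which leaves fewer
    than [A t ^ 2] cells per axis. *)
Lemma root_count : exists A : nat, forall (t : nat) (vs : seq 'cV[R]_n),
  (0 < t)%N -> uniq vs ->
  (forall v, v \in vs -> [/\ is_root v, nonneg v & h v <= t%:R]) ->
  (size vs <= (A * t ^ 2) ^ n)%N.
Proof.
have [C C0 sep] := root_separation; have [L L0 Lh] := nonneg_coord.
pose D := (Num.truncn C).+1; pose A := (Num.truncn (L * D%:R + 1)).+1.
have CD : C < D%:R by exact: truncnS_gt.
have D0 : 0 < D%:R :> R by rewrite ltr0n.
exists A => t vs t0 uvs rvs.
have t1 : 1 <= t%:R :> R by rewrite ler1n.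
have At : (0 < A * t ^ 2)%N by rewrite muln_gt0 expn_gt0 t0.
pose scale (x : R) := x * (D * t)%:R.
pose f (v : 'cV[R]_n) : {ffun 'I_n -> 'I_(A * t ^ 2).-1.+1} :=
  [ffun i => inord (Num.truncn (scale (v i 0)))].
have fE v i : v \in vs -> f v i = Num.truncn (scale (v i 0)) :> nat.
  move=> /rvs[rv v0 vt]; rewrite ffunE inordK// prednK//.
  rewrite truncn_lt_nat ?mulr_ge0// /scale natrM.
  have vL : v i 0 <= L * t%:R by rewrite (le_trans (Lh _ _ v0))// ler_wpM2l// ltW.
  apply: le_lt_trans (_ : L * t%:R * (D%:R * t%:R) < _).
    by rewrite ler_wpM2r ?mulr_ge0.
  have : L * D%:R + 1 < A%:R by exact: truncnS_gt.
  rewrite natrM natrX expr2 => LDA.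
  have -> : L * t%:R * (D%:R * t%:R) = (L * D%:R) * (t%:R * t%:R) by ring.
  rewrite ltr_pM2r ?mulr_gt0 ?ltr0n//; lra.
have finj : {in vs &, injective f}.
  move=> u v uvs' vvs fuv; apply: contrapT => uv.
  have [ru u0 ut] := rvs _ uvs'; have [rv v0 vt] := rvs _ vvs.
  have Dt0 : 0 < (D * t)%:R :> R by rewrite ltr0n muln_gt0.
  have : 1 <= C * ((D * t)%:R^-1 * t%:R) ^+ 2.
    apply: (sep u v) => // i.
    have fi : Num.truncn (scale (u i 0)) = Num.truncn (scale (v i 0)).
      by rewrite -!fE// fuv.
    rewrite -[leRHS]mul1r ler_pdivlMr// -(gtr0_norm Dt0) -normrM mulrBl.
    rewrite -/(scale _) -/(scale (v i 0)).
    have su : 0 <= scale (u i 0) by rewrite mulr_ge0.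
    have sv : 0 <= scale (v i 0) by rewrite mulr_ge0.
    have := truncn_itv su; have := truncn_itv sv; rewrite fi -natr1.
    by rewrite ler_norml => /andP[? ?] /andP[? ?]; apply/andP; split; lra.
  rewrite natrM invfM -mulrA mulVf ?mulr1 ?gt_eqF ?(lt_le_trans ltr01)//.
  rewrite exprVn ler_pdivlMr ?exprn_gt0// mul1r leNgt => /negP; apply.
  by apply: lt_le_trans CD _; rewrite expr2 ler_peMl ?ler1n.
have ufvs : uniq (map f vs) by rewrite (map_inj_in_uniq finj).
rewrite -(size_map f) -(card_uniqP ufvs); apply: leq_trans (max_card _) _.
by rewrite card_ffun !card_ord prednK.
Qed.

End Roots.

(** * Growth of the orbit *)

Section RealRoot.
Variables (R : realType) (D : nat).
Hypothesis D0 : (0 < D)%N.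

Definition nat_root (k : nat) : R := k%:R `^ D%:R^-1.

Local Notation rt := nat_root.

Lemma nat_root_ge0 k : 0 <= rt k. Proof. exact: powR_ge0. Qed.

Lemma nat_root_gt0 k : (0 < k)%N -> 0 < rt k.
Proof. by move=> k0; rewrite powR_gt0// ltr0n. Qed.

Lemma nat_rootX k : rt k ^+ D = k%:R.
Proof.
rewrite -powR_mulrn ?nat_root_ge0// -powRrM mulVf ?powRr1//.
by rewrite pnatr_eq0 -lt0n.
Qed.

Lemma nat_root_le (k : nat) (x : R) : 0 <= x -> k%:R <= x ^+ D -> rt k <= x.
Proof.
move=> x0; rewrite -nat_rootX; rewrite ler_pXn2r// ?nnegrE//.
exact: nat_root_ge0.
Qed.

Lemma nat_root_mono k l : (k <= l)%N -> rt k <= rt l.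
Proof.
by move=> kl; apply: nat_root_le; rewrite ?nat_root_ge0// nat_rootX ler_nat.
Qed.

Lemma nat_root_double k l : (k <= l.*2)%N -> rt k <= 2 * rt l.
Proof.
move=> kl; apply: nat_root_le; first by rewrite mulr_ge0 ?nat_root_ge0.
rewrite exprMn nat_rootX; apply: le_trans (_ : 2 * l%:R <= _).
  by rewrite -natrM ler_nat mul2n.
by rewrite ler_wpM2r// -natrX ler_nat -[X in (X <= _)%N]expn1 leq_pexp2l.
Qed.

(** Factoring [b ^ D - a ^ D = 1] for consecutive roots gives [1 <= (b - a) D b ^ (D - 1)]. The
    inverse of the height bound is thereby dominated by a telescoping, hence summable, series. *)
Lemma nat_root_telescope k : (0 < k)%N ->
  (k.+1%:R * rt k.+1)^-1 <= D%:R * ((rt k)^-1 - (rt k.+1)^-1).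
Proof.
move=> k0; have a0 := nat_root_gt0 k0; have b0 := nat_root_gt0 (ltn0Sn k).
have ab := nat_root_mono (leqnSn k).
have : rt k.+1 ^+ D - rt k ^+ D = 1.
  by rewrite !nat_rootX -natr1 addrAC subrr add0r.
rewrite -(nat_rootX k.+1).
set a := rt k in a0 ab *; set b := rt k.+1 in b0 ab *.
rewrite subrXX => e1.
have le1 : 1 <= (b - a) * (D%:R * b ^+ D.-1).
  rewrite -{1}e1 ler_wpM2l ?subr_ge0//.
  apply: le_trans (_ : \sum_(i < D) b ^+ D.-1 <= _).
    apply: ler_sum => i _; apply: le_trans (_ : b ^+ (D.-1 - i) * b ^+ i <= _).
      rewrite -subn1 -subnDA add1n ler_wpM2l ?exprn_ge0 ?(ltW b0)//.
      by rewrite lerXn2r// nnegrE ltW.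
    by rewrite -exprD subnK// -ltnS prednK.
  by rewrite sumr_const card_ord mulr_natl.
have -> : a^-1 - b^-1 = (b - a) / (a * b) by field; rewrite !gt_eqF.
rewrite -[leLHS]mul1r ler_pdivrMr ?mulr_gt0 ?exprn_gt0//.
apply: le_trans le1 _.
have bD : b ^+ D = b * b ^+ D.-1 by rewrite -exprS prednK.
have q0 : 0 <= (b - a) * (D%:R * b ^+ D.-1).
  by rewrite mulr_ge0 ?subr_ge0// mulr_ge0 ?exprn_ge0// ltW.
have -> : D%:R * ((b - a) / (a * b)) * (b ^+ D * b) =
    (b - a) * (D%:R * b ^+ D.-1) * (b / a).
  by rewrite bD; field; rewrite !gt_eqF.
by rewrite ler_peMr// ler_pdivlMr// mul1r.
Qed.

End RealRoot.

(** * Inversions of a word and the lower bound for heights *)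

Section Growth.
Variables (R : realType) (n : nat) (m : coxeterMatrix n) (W : coxeterSystem m).
Variables (B : 'M[R]_n) (rho : W -> 'M[R]_n) (o : 'cV[R]_n).
Hypotheses (Bcox : coxeter_form m B) (rhoB : geometric_action B rho).
Hypotheses (Bsig : signature B n.-1 1) (oneg : negative_direction B o).
Implicit Types (i j s t : 'I_n) (u v : 'cV[R]_n) (w g : W) (x y : seq 'I_n).

Local Notation gen := (cox_gen W).
Local Notation len := (@word_length n m W).
Local Notation al := (alpha R).
Local Notation h := (norm1 o).
Local Notation prod := (word_prod W).

Definition orbit_height w := h (rho w *m o).

(** The argument [g] accumulates the prefix already read. For [g = 1] and [x] reduced these are the
    positive roots made negative by the inverse of [word_prod x]. *)
Fixpoint inversions g x : seq 'cV[R]_n :=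
  if x is i :: x' then rho g *m al i :: inversions (g * gen i)%g x' else [::].

Lemma inversions_rcons g x i :
  inversions g (rcons x i) = rcons (inversions g x) (rho (g * prod x)%g *m al i).
Proof.
elim: x g => [|j x IH] g /=; first by rewrite /word_prod big_nil mulg1.
by rewrite IH word_prod_cons mulgA.
Qed.

Lemma size_inversions g x : size (inversions g x) = size x.
Proof. by elim: x g => //= i x IH g; rewrite IH. Qed.

Lemma mem_inversions g x v : v \in inversions g x ->
  exists x1 i x2, x = x1 ++ i :: x2 /\ v = rho (g * prod x1)%g *m al i.
Proof.
elim: x g => //= i x IH g; rewrite inE => /predU1P[->|/IH[x1 [j [x2 [-> ->]]]]].
  by exists [::], i, x; rewrite /word_prod big_nil mulg1.
by exists (i :: x1), j, x2; rewrite word_prod_cons mulgA.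
Qed.

Definition reduced x := len (prod x) = size x.

Lemma reduced_cat x y : reduced (x ++ y) -> reduced x /\ reduced y.
Proof.
rewrite /reduced word_prod_cat size_cat => xy.
have := word_lengthM (prod x) (prod y).
have := word_length_le W x; have := word_length_le W y; lia.
Qed.

Lemma reduced_rcons_root x i : reduced (rcons x i) ->
  is_root rho (rho (prod x) *m al i) /\ nonneg (rho (prod x) *m al i).
Proof.
rewrite -cats1 => xi; split; first by exists (prod x), i.
apply: (simple_root_nonneg Bcox rhoB).
have [-> _] := reduced_cat xi.
by rewrite -word_prod_rcons -cats1 xi size_cat addn1.
Qed.

Lemma inversions_root x v : reduced x -> v \in inversions 1%g x ->
  is_root rho v /\ nonneg v.
Proof.
move=> rx /mem_inversions[x1 [i [x2 [xE ->]]]]; rewrite mul1g.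
apply: reduced_rcons_root; move: rx.
by rewrite xE -cat_rcons => /reduced_cat[].
Qed.

(** If two entries agree, cancelling the common prefix and the letter [j] shows that the reduced
    word [rcons x2 i] has last inversion [- alpha j], which is not nonnegative. *)
Lemma inversions_uniq x : reduced x -> uniq (inversions 1%g x).
Proof.
elim/last_ind: x => // x i IH rxi.
have [rx _] : reduced x /\ reduced [:: i] by apply: reduced_cat; rewrite cats1.
rewrite inversions_rcons rcons_uniq IH// andbT; apply/negP.
move=> /mem_inversions[x1 [j [x2 [xE]]]]; rewrite !mul1g xE word_prod_cat.
rewrite (rhoM rhoB) -mulmxA => /(congr1 (mulmx (rho (prod x1)^-1%g))).
rewrite !(rhoVK rhoB) word_prod_cons (rhoM rhoB) -mulmxA.
move=> /(congr1 (mulmx (rho (gen j)^-1%g))).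
rewrite (rhoVK rhoB) cox_genV (rho_simple Bcox rhoB) => x2i.
have r2 : reduced (rcons x2 i).
  by move: rxi; rewrite xE rcons_cat /= -cat_rcons => /reduced_cat[].
have [_ /(_ j)] := reduced_rcons_root r2.
by rewrite x2i !mxE !eqxx oppr_ge0 ler10.
Qed.

Lemma orbit_height1 : orbit_height 1%g = 1.
Proof. by rewrite /orbit_height (rho1 rhoB) mul1mx (norm1_o oneg). Qed.

(** As [o] is an eigenvector, [s_i] moves it by [-2 la o_i] times [alpha i], a positive multiple;
    [c] bounds the [o_i] below since simple roots are roots. *)
Lemma orbit_heightMgen : exists2 c, 0 < c & forall w i,
  nonneg (rho w *m al i) ->
  orbit_height w + c * h (rho w *m al i) <= orbit_height (w * gen i)%g.
Proof.
have [c c0 hc] := root_norm1 Bcox rhoB oneg.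
have [la la0 Bo] := bform_o Bcox oneg.
exists (-2 * la * c); first by rewrite mulr_gt0// nmulr_rgt0// oppr_lt0.
move=> w i wi.
have hi : 0 <= h (rho w *m al i).
  by rewrite /Defs.norm1 sumr_ge0// => k _; rewrite mulr_ge0// ltW// (o_gt0 oneg).
rewrite /orbit_height (rhoM rhoB) -mulmxA (rho_gen rhoB) mulmxBr -scalemxAr.
rewrite norm1D norm1N norm1Z (bform_sym Bcox) Bo norm1_alpha lerD2l.
have : c <= `|h (al i)|.
  by apply: hc; exists 1%g, i; rewrite (rho1 rhoB) mul1mx.
rewrite norm1_alpha gtr0_norm ?(o_gt0 oneg)// => ci.
rewrite -mulNr ler_wpM2r//; nra.
Qed.

Lemma orbit_height_inversions : exists2 c, 0 < c & forall x, reduced x ->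
  1 + c * \sum_(v <- inversions 1%g x) h v <= orbit_height (prod x).
Proof.
have [c c0 hc] := orbit_heightMgen; exists c => //; elim/last_ind => [|x i IH] rxi.
  by rewrite big_nil mulr0 addr0 /word_prod big_nil orbit_height1.
have [rx _] : reduced x /\ reduced [:: i] by apply: reduced_cat; rewrite cats1.
have [_ xi] := reduced_rcons_root rxi.
rewrite inversions_rcons -cats1 big_cat/= big_seq1 mulrDr addrA mul1g.
by rewrite word_prod_rcons; apply: le_trans (hc _ _ xi); rewrite lerD2r IH.
Qed.

Lemma orbit_height_gt0 w : 0 < orbit_height w.
Proof.
have [x <- xr] := reduced_word w; have [c c0 hc] := orbit_height_inversions.
apply: lt_le_trans (hc x (esym xr)); rewrite ltr_pwDl// mulr_ge0 ?(ltW c0)//.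
rewrite big_seq sumr_ge0// => v /(inversions_root (esym xr))[_ v0].
by rewrite /Defs.norm1 sumr_ge0// => k _; rewrite mulr_ge0// ltW// (o_gt0 oneg).
Qed.

(* At most half of the [k = len w] inversions have height [<= t], as long as
   [t] is at most of order [k ^ (1 / 2n)]; the others contribute [k t / 2]. *)
Theorem orbit_height_growth : exists2 D : nat, (0 < D)%N &
  exists2 c : R, 0 < c & forall w,
    c * ((len w)%:R * nat_root R D (len w)) <= orbit_height w.
Proof.
have n0 : (0 < n)%N.
  rewrite lt0n; apply/eqP => n0; case: oneg => _ /eqP + _.
  rewrite big1 => [|i _]; first by rewrite eq_sym oner_eq0.
  by have := ltn_ord i; rewrite [X in (_ < X)%N]n0.
have [A0 Acount] := root_count Bcox rhoB Bsig oneg.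
have [c c0 hc] := orbit_height_inversions.
have [d d0 hd] := root_norm1 Bcox rhoB oneg.
pose A := A0.+1; pose K := (2 * A ^ n)%N.
have K0 : (0 < K)%N by rewrite muln_gt0 expn_gt0.
(* [e] merges the bounds [sum1] and [sum2] into one of order [k * t.+1]; [sum1] supplies the extra
   1, which matters when [t = 0]. *)
pose e := Num.min d 2^-1.
have e0 : 0 < e by rewrite lt_min d0 invr_gt0 ltr0n.
have D0 : (0 < 2 * n)%N by rewrite muln_gt0.
exists (2 * n)%N => //.
exists (c * (e / 2) / K%:R); first by rewrite !divr_gt0 ?mulr_gt0 ?divr_gt0 ?ltr0n.
move=> w; have [x <- xr] := reduced_word w; rewrite -xr.
set k := size x; set vs := inversions 1%g x.
have rvs v : v \in vs -> is_root rho v /\ nonneg v by apply: inversions_root.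
have hvs v : v \in vs -> d <= h v.
  by move=> /rvs[rv v0]; rewrite -[h v]gtr0_norm ?hd// (root_nonneg_gt0 Bcox rhoB oneg).
have kvs : size vs = k by rewrite size_inversions.
have sum1 : d * k%:R <= \sum_(v <- vs) h v.
  rewrite -kvs -sum1_size natr_sum mulr_sumr big_seq [leRHS]big_seq.
  by apply: ler_sum => v /hvs; rewrite mulr1.
pose P (t : nat) := (2 * (A * t ^ 2) ^ n <= k)%N.
have P0 : P 0%N by rewrite /P muln0 exp0n.
have Pub (t : nat) : P t -> (t <= k)%N.
  case: t => [//|t]; apply: leq_trans; apply: leq_trans (leq_pmull _ (ltn0Sn 1)).
  apply: leq_trans (_ : (A * t.+1 ^ 2) ^ 1 <= _)%N.
    by rewrite expn1 /A; nia.
  by rewrite leq_pexp2l// muln_gt0 expn_gt0.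
have [t Pt tmax] := ex_maxnP (ex_intro P 0%N P0) Pub.
have sum_ge0 : 0 <= \sum_(v <- vs) h v.
  by rewrite (le_trans _ sum1)// mulr_ge0// ltW.
have sum2 : 2^-1 * (k%:R * t%:R) <= \sum_(v <- vs) h v.
  have [->|t0] := posnP t; first by rewrite !mulr0.
  pose small := [seq v <- vs | h v <= t%:R].
  have small_le : (2 * size small <= k)%N.
    apply: leq_trans Pt; rewrite leq_mul2l/=.
    apply: leq_trans (_ : (A0 * t ^ 2) ^ n <= _)%N; last first.
      by rewrite leq_exp2r// leq_mul2r leqnSn orbT.
    apply: Acount => // [|v]; first by rewrite filter_uniq// inversions_uniq.
    by rewrite mem_filter => /andP[vt /rvs[]].
  have -> : \sum_(v <- vs) h v =
      \sum_(v <- small) h v + \sum_(v <- vs | ~~ (h v <= t%:R)) h v.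
    by rewrite big_filter [LHS](bigID (fun v => h v <= t%:R)).
  have s0 : 0 <= \sum_(v <- small) h v.
    rewrite big_seq sumr_ge0// => v; rewrite mem_filter => /andP[_ /hvs].
    by apply: le_trans; exact: ltW.
  have s1 : t%:R * (count (fun v => ~~ (h v <= t%:R)) vs)%:R <=
      \sum_(v <- vs | ~~ (h v <= t%:R)) h v.
    rewrite -sum1_count natr_sum mulr_sumr; apply: ler_sum => v.
    by rewrite -ltNge mulr1 => /ltW.
  have kE : (size small + count (fun v => ~~ (h v <= t%:R)%R) vs = k)%N.
    by rewrite size_filter -kvs; exact: count_predC.
  move: s1; set q := count _ _ in kE * => s1.
  have : k%:R <= 2 * q%:R :> R by rewrite -natrM ler_nat; lia.
  have : 0 <= t%:R :> R by [].
  nra.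
(* Maximality of [t] means that [t.+1] violates [P], so [k] is less than [K * t.+1 ^ (2 n)]. *)
have rtk : nat_root R (2 * n) k <= K%:R * t.+1%:R.
  apply: nat_root_le => //; rewrite -natrM -natrX ler_nat.
  have : ~~ P t.+1 by apply/negP => /tmax; rewrite ltnn.
  rewrite /P -ltnNge => /ltnW/leq_trans; apply.
  rewrite expnMn -expnM mulnA -/K expnMn leq_mul2r.
  by rewrite -[X in (X <= _)%N]expn1 leq_pexp2l// orbT.
have eS : e / 2 * (k%:R * t.+1%:R) <= \sum_(v <- vs) h v.
  have ed : e * k%:R <= d * k%:R by rewrite ler_wpM2r// ge_min lexx.
  have e2 : e * (k%:R * t%:R) <= 2^-1 * (k%:R * t%:R).
    by rewrite ler_wpM2r// ?mulr_ge0// ge_min lexx orbT.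
  have -> : e / 2 * (k%:R * t.+1%:R) = (e * (k%:R * t%:R) + e * k%:R) / 2.
    by rewrite -natr1; ring.
  by lra.
apply: le_trans (hc _ (esym xr)); rewrite -/vs.
apply: le_trans (_ : c * (e / 2 * (k%:R * t.+1%:R)) <= _); last first.
  by rewrite ler_wpDl// ler_wpM2l// ltW.
rewrite -!mulrA ler_wpM2l ?(ltW c0)// ler_wpM2l ?(ltW e0)// ler_wpM2l ?invr_ge0//.
rewrite mulrCA ler_wpM2l// ler_pdivrMl ?ltr0n//.
Qed.

End Growth.

(** * Distances between orbit points *)

Section OrbitEstimates.
Variables (R : realType) (n : nat) (m : coxeterMatrix n) (W : coxeterSystem m).
Variables (B : 'M[R]_n) (rho : W -> 'M[R]_n) (o : 'cV[R]_n).
Hypotheses (Bcox : coxeter_form m B) (rhoB : geometric_action B rho).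
Hypotheses (Bsig : signature B n.-1 1) (oneg : negative_direction B o).
Implicit Types (i j s t : 'I_n) (u v z : 'cV[R]_n) (w g : W) (x y : seq 'I_n).

Local Notation gen := (cox_gen W).
Local Notation len := (@word_length n m W).
Local Notation al := (alpha R).
Local Notation h := (norm1 o).
Local Notation prod := (word_prod W).
Local Notation height := (orbit_height rho o).
Local Notation pt w := (normalized_action rho o w o).

Lemma posdef_cauchy_schwarz u v : h u = 0 -> h v = 0 ->
  bform B u v ^+ 2 <= bform B u u * bform B v v.
Proof.
move=> hu hv; have [->|v0] := eqVneq v 0.
  by rewrite /bform !mulmx0 !mxE expr0n mulr0.
have Bv := posdef Bcox Bsig oneg hv v0.
pose z := bform B v v *: u - bform B u v *: v.
have : 0 <= bform B z z.
  by apply: (posdef_ge0 Bcox Bsig oneg); rewrite norm1D norm1N !norm1Z hu hv !mulr0 subrr.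
have -> : bform B z z = bform B v v * (bform B u u * bform B v v - bform B u v ^+ 2).
  by rewrite !bformE (bform_sym Bcox v u); ring.
by rewrite pmulr_rge0// subr_ge0.
Qed.

(** Pairing a kernel vector with [o] shows that it has height 0, where the form is positive
    definite. *)
Lemma gram_unitmx : B \in unitmx.
Proof.
rewrite -row_free_unit -kermx_eq0; apply/rowV0P => r /sub_kermxP rB.
have [Bsym _] := Bcox; have [la la0 Bo] := bform_o Bcox oneg.
have Br : B *m r^T = 0 by rewrite -[B]Bsym -trmx_mul rB trmx0.
have hr : h r^T = 0.
  have := Bo r^T; rewrite /bform -mulmxA Br mulmx0 mxE => /esym/eqP.
  by rewrite mulf_eq0 lt_eqF//= => /eqP.
apply/eqP; rewrite -trmx_eq0; apply/negPn/negP => /(posdef Bcox Bsig oneg hr).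
by rewrite /bform -mulmxA Br mulmx0 mxE ltxx.
Qed.

(** On vectors of height 0, the [i]-th coordinate is the form against [invmx B *m al i]. Subtracting
    a multiple of [o] makes this vector of height 0 too without changing those values, and
    Cauchy-Schwarz concludes. *)
Lemma posdef_coercive : exists2 C, 0 < C & forall v i, h v = 0 ->
  v i 0 ^+ 2 <= C * bform B v v.
Proof.
have [la la0 Bo] := bform_o Bcox oneg.
pose z0 i := invmx B *m al i; pose z i := z0 i - h (z0 i) *: o.
have hz i : h (z i) = 0.
  by rewrite norm1D norm1N norm1Z (norm1_o oneg) mulr1 subrr.
have Bz i v : h v = 0 -> bform B (z i) v = v i 0.
  move=> hv; rewrite !bformE Bo hv !mulr0 oppr0 addr0 (bform_sym Bcox).
  by rewrite /bform -mulmxA mulKVmx ?gram_unitmx// /alpha -colE !mxE.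
exists (1 + \sum_i bform B (z i) (z i)).
  by rewrite ltr_pwDl// sumr_ge0// => i _; exact: (posdef_ge0 Bcox Bsig oneg).
move=> v i hv; rewrite -(Bz i)//; apply: le_trans (posdef_cauchy_schwarz (hz i) hv) _.
rewrite ler_wpM2r ?(posdef_ge0 Bcox Bsig oneg)// (bigD1 i)//= addrCA lerDl.
by rewrite addr_ge0// sumr_ge0// => j _; exact: (posdef_ge0 Bcox Bsig oneg).
Qed.

Lemma norm1_pt w : h (pt w) = 1.
Proof.
rewrite /normalized_action /normalize norm1Z mulVf// gt_eqF//.
exact: (orbit_height_gt0 Bcox rhoB oneg).
Qed.

Lemma bform_pt w g :
  bform B (pt w) (pt g) = bform B o (rho (w^-1 * g)%g *m o) / (height w * height g).
Proof.
rewrite /normalized_action /normalize bformZl bformZr (rhoM rhoB) -mulmxA.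
rewrite -[in RHS](bform_rho Bcox rhoB w) (mulmxA (rho w) (rho w^-1%g)).
rewrite -(rhoM rhoB) mulgV (rho1 rhoB) mul1mx /orbit_height invfM; ring.
Qed.

(** The difference of two orbit points has height 0, so its coordinates are controlled by the form.
    The diagonal terms are negative, and the cross term depends only on [i] up to the product of the
    heights. *)
Lemma pt_step : exists2 C, 0 < C & forall w i j,
  (pt w j 0 - pt (w * gen i)%g j 0) ^+ 2 <= C / (height w * height (w * gen i)%g).
Proof.
have [C C0 HC] := posdef_coercive.
have [la la0 Bo] := bform_o Bcox oneg.
pose K := 1 + \sum_i `|2 * bform B o (rho (gen i) *m o)|.
have K0 : 0 < K by rewrite ltr_pwDl// sumr_ge0.
exists (C * K); first by rewrite mulr_gt0.
move=> w i j; set g := (w * gen i)%g.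
have a0 := orbit_height_gt0 Bcox rhoB oneg w.
have b0 := orbit_height_gt0 Bcox rhoB oneg g.
have := HC (pt w - pt g) j; rewrite norm1D norm1N !norm1_pt subrr => /(_ erefl).
rewrite !mxE => /le_trans; apply; rewrite -mulrA ler_wpM2l ?(ltW C0)//.
rewrite !(bformDl, bformDr, bformNl, bformNr) (bform_sym Bcox (pt g)) !bform_pt !mulVg (rho1 rhoB) mul1mx.
rewrite Bo (norm1_o oneg) mulr1 mulKg.
have aa : la / (height w * height w) <= 0 by rewrite mulr_le0_ge0 ?invr_ge0 ?mulr_ge0 ?ltW.
have bb : la / (height g * height g) <= 0 by rewrite mulr_le0_ge0 ?invr_ge0 ?mulr_ge0 ?ltW.
apply: le_trans (_ : `|2 * bform B o (rho (gen i) *m o)| / (height w * height g) <= _).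
  set q := bform _ _ _; have qq := ler_norm (- (2 * q)); rewrite normrN in qq.
  have : - (2 * q) / (height w * height g) <= `|2 * q| / (height w * height g).
    by rewrite ler_pM2r// invr_gt0 mulr_gt0.
  lra.
rewrite ler_pM2r ?invr_gt0 ?mulr_gt0// /K (bigD1 i)//= addrCA lerDl.
by rewrite addr_ge0// sumr_ge0.
Qed.

(** Along the path the length is at least half of [k.+1 + l], so the steps are summable and their
    bounds telescope. *)
Theorem pt_path : exists2 D : nat, (0 < D)%N & exists2 C : R, 0 < C &
  forall k w x j, (0 < k)%N ->
    (forall l, (l <= size x)%N -> (k.+1 + l <= (len (w * prod (take l x))%g).*2)%N) ->
    `|pt w j 0 - pt (w * prod x)%g j 0| <=
      C * ((nat_root R D k)^-1 - (nat_root R D (k + size x))^-1).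
Proof.
have [D D0 [c c0 growth]] := orbit_height_growth Bcox rhoB Bsig oneg.
have [C C0 step] := pt_step.
exists D => //; pose E := (C + 1) * (4 / c).
have E0 : 0 < E by rewrite mulr_gt0 ?addr_gt0// divr_gt0.
exists (E * D%:R); first by rewrite mulr_gt0// ltr0n.
(* One factor 2 in [c / 4] comes from [k <= 2 len w], the other from comparing the roots by
   [nat_root_double]. *)
have low w k : (0 < k)%N -> (k <= (len w).*2)%N ->
    c / 4 * (k%:R * nat_root R D k) <= height w.
  move=> k0 kl; apply: le_trans (growth w).
  rewrite -mulrA ler_wpM2l ?(ltW c0)//.
  have kl' : k%:R <= 2 * (len w)%:R :> R by rewrite -natrM ler_nat mul2n.
  have := nat_root_double R D0 kl; have := nat_root_ge0 R D k.
  set a := nat_root _ _ _; set b := nat_root _ _ _ => a0 ab.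
  have : k%:R * a <= (2 * (len w)%:R) * (2 * b) by rewrite ler_pM.
  by move=> kab; rewrite mulrC ler_pdivrMr//; lra.
have step' w i j k : (0 < k)%N -> (k <= (len w).*2)%N -> (k <= (len (w * gen i)%g).*2)%N ->
    `|pt w j 0 - pt (w * gen i)%g j 0| <= E / (k%:R * nat_root R D k).
  move=> k0 k1 k2; have q0 : 0 < k%:R * nat_root R D k.
    by rewrite mulr_gt0 ?ltr0n ?nat_root_gt0.
  set q := _ * nat_root _ _ _ in q0 *.
  have cq : 0 < c / 4 * q by rewrite mulr_gt0 ?divr_gt0.
  rewrite -(@ler_pXn2r _ 2) ?nnegrE//; last by rewrite divr_ge0 ?ltW.
  rewrite real_normK ?num_real//; apply: le_trans (step w i j) _.
  apply: le_trans (_ : C / (c / 4 * q) ^+ 2 <= _).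
    have hh : 0 < height w * height (w * gen i)%g.
      by rewrite mulr_gt0// (orbit_height_gt0 Bcox rhoB oneg).
    rewrite ler_wpM2l ?(ltW C0)// lef_pV2 ?posrE ?exprn_gt0// expr2.
    exact: ler_pM (ltW cq) (ltW cq) (low _ _ k0 k1) (low _ _ k0 k2).
  have -> : (E / q) ^+ 2 = (C + 1) ^+ 2 / (c / 4 * q) ^+ 2.
    by rewrite /E; field; rewrite !gt_eqF.
  rewrite ler_wpM2r ?invr_ge0 ?exprn_ge0 ?(ltW cq)//.
  by rewrite sqrrD1; have := sqr_ge0 C; lra.
move=> k w x j k0; elim/last_ind: x => [|x i IH] xk.
  by rewrite /word_prod big_nil mulg1 addn0 !subrr normr0 mulr0.
have xl : (size x <= size (rcons x i))%N by rewrite size_rcons.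
have {}IH : `|pt w j 0 - pt (w * prod x)%g j 0| <=
    E * D%:R * ((nat_root R D k)^-1 - (nat_root R D (k + size x))^-1).
  apply: IH => l lx; have := xk l (leq_trans lx xl).
  by rewrite -cats1 takel_cat.
have k1 := xk _ xl; have k2 := xk _ (leqnn _).
rewrite -cats1 take_size_cat// in k1; rewrite take_size word_prod_rcons mulgA size_rcons in k2.
have {}k2 : ((k + size x).+1 <= (len (w * prod x * gen i)%g).*2)%N.
  by apply: leq_trans k2; rewrite addSn addnS.
have {}k1 : ((k + size x).+1 <= (len (w * prod x)%g).*2)%N.
  by apply: leq_trans k1; rewrite addSn.
have st := step' _ i j (k + size x).+1 isT k1 k2.
have tel : E / ((k + size x).+1%:R * nat_root R D (k + size x).+1) <=
    E * D%:R * ((nat_root R D (k + size x))^-1 - (nat_root R D (k + size x).+1)^-1).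
  rewrite -mulrA ler_wpM2l ?(ltW E0)//.
  by apply: nat_root_telescope; rewrite // addn_gt0 k0.
rewrite word_prod_rcons mulgA size_rcons addnS.
apply: le_trans (ler_distD (pt (w * prod x)%g j 0) _ _) _.
by apply: le_trans (lerD IH (le_trans st tel)) _; rewrite -mulrDr addrA subrK.
Qed.

(* A geodesic from [g] to [w] stays outside the ball of radius [(g|w)], and
   its point at distance [t] from the [|g|]-th one has length [>= t]. *)
Theorem pt_close (e : R) : 0 < e -> exists M : R, forall g w j,
  M <= gromov_product R g w -> `|pt g j 0 - pt w j 0| <= e.
Proof.
move=> e0; have [D D0 [C C0 path]] := pt_path.
(* [k] makes the whole tail bound at most [e / 2], for use on each half of the geodesic. *)
have [k k0 ke] : exists2 k, (0 < k)%N & C / nat_root R D k <= e / 2.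
  have C1 : 0 <= 2 * C / e by rewrite divr_ge0 ?mulr_ge0 ?ltW.
  pose k := ((Num.truncn (2 * C / e)).+1 ^ D)%N.
  have k0 : (0 < k)%N by rewrite expn_gt0.
  exists k => //; rewrite ler_pdivrMr ?nat_root_gt0//.
  have : 2 * C / e <= nat_root R D k.
    rewrite -(@ler_pXn2r _ D) ?nnegrE ?nat_root_ge0// nat_rootX//.
    rewrite natrX ler_pXn2r ?nnegrE//.
    exact/ltW/truncnS_gt.
  by rewrite ler_pdivrMr//; lra.
exists k.+1%:R => g w j; rewrite ler_pdivlMr// lerBrDr -!natrD -natrM -natrD ler_nat.
rewrite /word_dist !mulg1 !word_lengthV.
have [x xE xsz] := reduced_word (g^-1 * w)%g; rewrite -xsz => gw.
have rx : reduced W x by rewrite /reduced xE.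
pose q l := (g * prod (take l x))%g.
have q1 l : (l <= size x)%N -> (len g <= len (q l) + l)%N.
  move=> lx; have -> : g = (q l * (prod (take l x))^-1)%g by rewrite mulgK.
  apply: leq_trans (word_lengthM _ _) _; rewrite leq_add2l word_lengthV.
  by rewrite (leq_trans (word_length_le _ _))// size_take_min geq_minl.
have q2 l : (l <= size x)%N -> (l <= len (q l) + len g)%N.
  move=> lx; have [rl _] : reduced W (take l x) /\ reduced W (drop l x).
    by apply: reduced_cat; rewrite cat_take_drop.
  have {1}-> : l = len (prod (take l x)) by rewrite rl size_takel.
  by have := word_lengthM g^-1%g (q l); rewrite word_lengthV mulKg addnC.
have q3 l : (l <= size x)%N -> (len w <= len (q l) + (size x - l))%N.
  move=> lx; have -> : w = (q l * prod (drop l x))%g.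
    by rewrite -mulgA -word_prod_cat cat_take_drop xE mulVKg.
  apply: leq_trans (word_lengthM _ _) _; rewrite leq_add2l.
  by rewrite (leq_trans (word_length_le _ _))// size_drop.
(* The geodesic is split at position [|g|], or at its end if it is shorter. Adding [q1] and [q3]
   gives [len (q l) >= k + 1]; adding the distance estimate, from [q2] ahead of [a] and [q1] behind
   it, gives the hypothesis of [pt_path]. *)
have [a aE] : exists a, a = minn (len g) (size x) by eexists.
have ax : (a <= size x)%N by rewrite aE geq_minr.
have forward : `|pt (q a) j 0 - pt w j 0| <= e / 2.
  have -> : w = (q a * prod (drop a x))%g.
    by rewrite -mulgA -word_prod_cat cat_take_drop xE mulVKg.
  apply: le_trans (path k _ _ j k0 _) _ => [l|].
    rewrite size_drop => lx.
    have -> : (q a * prod (take l (drop a x)) = q (a + l)%N)%g.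
      by rewrite /q -mulgA -word_prod_cat -takeD.
    have lx' : (a + l <= size x)%N by lia.
    move: (q1 _ lx') (q2 _ lx') (q3 _ lx') gw aE lx; clear; lia.
  apply: le_trans ke; rewrite ler_wpM2l ?(ltW C0)// gerBl invr_ge0.
  exact: nat_root_ge0.
have backward : `|pt (q a) j 0 - pt g j 0| <= e / 2.
  have -> : g = (q a * prod (rev (take a x)))%g by rewrite word_prod_rev mulgK.
  apply: le_trans (path k _ _ j k0 _) _ => [l|].
    rewrite size_rev size_takel// => la.
    have -> : (q a * prod (take l (rev (take a x))) = q (a - l)%N)%g.
      rewrite take_rev word_prod_rev size_takel//.
      rewrite /q -{1}(cat_take_drop (a - l) (take a x)) word_prod_cat mulgA mulgK.
      by rewrite take_takel ?leq_subr.
    have lx' : (a - l <= size x)%N by lia.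
    move: (q1 _ lx') (q2 _ lx') (q3 _ lx') gw aE la; clear; lia.
  apply: le_trans ke; rewrite ler_wpM2l ?(ltW C0)// gerBl invr_ge0.
  exact: nat_root_ge0.
apply: le_trans (ler_distD (pt (q a) j 0) _ _) _.
by rewrite distrC; lra.
Qed.

End OrbitEstimates.

(** * The boundary map *)

Section BoundaryMap.
Variables (R : realType) (n : nat) (m : coxeterMatrix n) (W : coxeterSystem m).
Variables (B : 'M[R]_n) (rho : W -> 'M[R]_n) (o : 'cV[R]_n).
Hypotheses (Bcox : coxeter_form m B) (rhoB : geometric_action B rho).
Hypotheses (Bsig : signature B n.-1 1) (oneg : negative_direction B o).
Implicit Types (i j : 'I_n) (u v z : 'cV[R]_n) (w g : W).

Local Notation gen := (cox_gen W).
Local Notation len := (@word_length n m W).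
Local Notation h := (norm1 o).
Local Notation pt w := (normalized_action rho o w o).
Local Notation height := (orbit_height rho o).
Local Notation bdry := (gromov_boundary R W).

Lemma filter_prod_ooP (A : set (nat * nat)) : filter_prod \oo \oo A <->
  exists N, forall k l, (N <= k)%N -> (N <= l)%N -> A (k, l).
Proof.
split=> [[[P Q] [[N1 _ P1] [N2 _ Q2]] PQ]|[N NA]].
  exists (maxn N1 N2) => k l; rewrite !geq_max => /andP[k1 _] /andP[_ l2].
  by apply: PQ; split; [apply: P1|apply: Q2].
exists ([set k | (N <= k)%N], [set k | (N <= k)%N]).
  by split; exists N.
by move=> [k l] [/= Nk Nl]; exact: NA.
Qed.

Lemma gromov_seqP (x : nat -> W) : gromov_seq R x <-> forall M : R, exists N,
  forall k l, (N <= k)%N -> (N <= l)%N -> M <= gromov_product R (x k) (x l).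
Proof.
rewrite /gromov_seq cvgryPge; split=> xP M; first by have /filter_prod_ooP := xP M.
exact/filter_prod_ooP/xP.
Qed.

Lemma gromov_liminf_gt (x y : nat -> W) (r : R) :
  (r%:E < gromov_liminf R x y)%E -> exists N,
  forall k l, (N <= k)%N -> (N <= l)%N -> r <= gromov_product R (x k) (y l).
Proof.
rewrite /gromov_liminf limf_einfE => /ereal_sup_gt[_ [V FV <-] rV].
have /filter_prod_ooP[N NV] := FV; exists N => k l Nk Nl.
rewrite -lee_fin (le_trans (ltW rV))//; apply: ereal_inf_lbound.
by exists (k, l) => //; exact: NV.
Qed.

Lemma cV_norm_le v (e : R) : 0 <= e -> (forall i, `|v i 0| <= e) -> `|v| <= e.
Proof.
move=> e0 ve; rewrite -[leLHS]/(mx_norm v) mx_normrE; apply/bigmax_leP; split=> // -[i j] _.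
by rewrite ord1; exact: ve.
Qed.

Lemma pt_close_norm (e : R) : 0 < e -> exists M : R, forall g w,
  M <= gromov_product R g w -> `|pt g - pt w| <= e.
Proof.
move=> e0; have [M MP] := pt_close Bcox rhoB Bsig oneg e0; exists M => g w gw.
by apply: cV_norm_le => [|j]; [exact: ltW|have := MP g w j gw; rewrite !mxE].
Qed.

Lemma gromov_seq_cvg (x : nat -> W) : gromov_seq R x ->
  cvg (pt (x k) @[k --> \oo]).
Proof.
move=> /gromov_seqP xP; apply/cauchy_cvgP/cauchy_ballP => e e0.
have e2 : 0 < e / 2 by rewrite divr_gt0.
have [M MP] := pt_close_norm e2.
have [N NP] := xP M.
exists ([set pt (x k) | k in [set k | (N <= k)%N]],
        [set pt (x k) | k in [set k | (N <= k)%N]]).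
  by split; exists N => // k Nk /=; exists k.
move=> [_ _] [[k Nk <-] [l Nl <-]] /=; rewrite -ball_normE /=.
by apply: le_lt_trans (MP _ _ (NP _ _ Nk Nl)) _; lra.
Qed.

Lemma lim_dist_le (f1 f2 : nat -> 'cV[R]_n) u v (e : R) N :
  f1 k @[k --> \oo] --> u -> f2 k @[k --> \oo] --> v ->
  (forall k, (N <= k)%N -> `|f1 k - f2 k| <= e) -> `|u - v| <= e.
Proof.
move=> f1u f2v fe.
have fuv : `|f1 k - f2 k| @[k --> \oo] --> `|u - v|.
  by apply: cvg_norm; exact: cvgB.
rewrite -(cvg_lim _ fuv)//; apply: limr_le; first exact: cvgP fuv.
by exists N.
Qed.

Definition seq_limit (x : gseq R W) : 'cV[R]_n := lim (pt (val x k) @[k --> \oo]).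

Lemma seq_limitP (x : gseq R W) : pt (val x k) @[k --> \oo] --> seq_limit x.
Proof. exact: (gromov_seq_cvg (asboolW (valP x))). Qed.

Lemma seq_limit_close (e : R) : 0 < e -> exists2 M : R, 0 < M &
  forall x y : gseq R W, (M%:E < gromov_liminf R (val x) (val y))%E ->
  `|seq_limit x - seq_limit y| <= e.
Proof.
(* The maximum with 1 gives a positive radius, as the subbasis of the boundary topology requires. *)
move=> e0; have [M MP] := pt_close_norm e0; exists (Num.max M 1).
  by rewrite lt_max ltr01 orbT.
move=> x y /gromov_liminf_gt[N NP].
apply: (lim_dist_le (N := N) (seq_limitP (x := x)) (seq_limitP (x := y))) => k Nk.
by apply: MP; apply: le_trans (NP _ _ Nk Nk); rewrite le_max lexx.
Qed.

Lemma seq_limit_gequiv (x y : gseq R W) : gequiv x y -> seq_limit x = seq_limit y.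
Proof.
move=> /asboolP; elim=> [{}x {}y xy|//|_ _ _ ->//|_ _ _ _ -> _ ->//].
apply/eqP; rewrite -subr_eq0 -normr_le0; apply/ler_addgt0Pr => e e0.
rewrite add0r; have [M _ MP] := seq_limit_close e0; apply: MP.
by rewrite xy ltry.
Qed.

Definition boundary_map (a : bdry) : 'cV[R]_n := seq_limit (repr a).

Lemma boundary_mapE (x : gseq R W) : boundary_map (boundary_class x) = seq_limit x.
Proof.
by apply: seq_limit_gequiv; apply/eqmodP; rewrite reprK.
Qed.

Lemma boundary_subbasis_open (U : set bdry) : boundary_subbasis U -> open U.
Proof.
move=> UB; exists [set U]; last by rewrite bigcup_set1.
move=> _ ->; exists [fset U]%fset; last by rewrite set_fset1 bigcap_set1.
by move=> V; rewrite in_fset1 => /eqP ->; exact: mem_set.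
Qed.

(** The subbasis set around [a] itself is a neighbourhood because [(a|a)] is infinite. For [b] in it
    other than [a], the infimum defining [(a|b)] bounds the liminf of the chosen representatives
    from below. *)
Lemma boundary_map_continuous : continuous boundary_map.
Proof.
move=> a; have Fa : Filter (nbhs a) by exact: nbhs_filter.
apply/(@cvgrPdist_le _ _ _ (nbhs a) Fa) => e e0; have [M M0 MP] := seq_limit_close e0.
pose U := [set b : bdry | (M%:E < boundary_product a b)%E].
have : nbhs a U.
  apply: open_nbhs_nbhs; split; first by apply: boundary_subbasis_open; exists a, M.
  by rewrite /U /= /boundary_product eqxx ltry.
apply: filterS => b; rewrite /U /= /boundary_product.
case: eqP => [<- _|_ Mab]; first by rewrite subrr normr0 ltW.
apply: MP; apply: lt_le_trans Mab _; apply: ereal_inf_lbound.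
exists (repr a), (repr b); split=> //; exact: reprK.
Qed.

Lemma cvg_mulmx p (A : 'M[R]_(p, n)) (f : nat -> 'cV[R]_n) u :
  f k @[k --> \oo] --> u -> A *m f k @[k --> \oo] --> A *m u.
Proof.
move=> fu; have mulE v : A *m v = \sum_j v j 0 *: col j A.
  apply/matrixP => i k; rewrite ord1 mxE summxE; apply: eq_bigr => j _.
  by rewrite !mxE mulrC.
rewrite mulE; under eq_cvg do rewrite mulE.
apply: cvg_big => [|j _]; first exact: add_continuous.
apply: cvgZ; last exact: cvg_cst.
exact: (cvg_comp _ _ fu (@coord_continuous _ _ _ j 0 u)).
Qed.

Lemma cvg_norm1 (f : nat -> 'cV[R]_n) u :
  f k @[k --> \oo] --> u -> h (f k) @[k --> \oo] --> h u.
Proof.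
move=> fu; apply: cvg_big => [|j _]; first exact: add_continuous.
apply: cvgM; first exact: cvg_cst.
exact: (cvg_comp _ _ fu (@coord_continuous _ _ _ j 0 u)).
Qed.

Lemma cvg_bform (f : nat -> 'cV[R]_n) u :
  f k @[k --> \oo] --> u -> bform B (f k) (f k) @[k --> \oo] --> bform B u u.
Proof.
move=> fu; have bE v : bform B v v = \sum_j v j 0 * (B *m v) j 0.
  by rewrite /bform -mulmxA mxE; apply: eq_bigr => j _; rewrite mxE.
rewrite bE; under eq_cvg do rewrite bE.
apply: cvg_big => [|j _]; first exact: add_continuous.
apply: cvgM; first exact: (cvg_comp _ _ fu (@coord_continuous _ _ _ j 0 u)).
exact: (cvg_comp _ _ (cvg_mulmx (A := B) fu) (@coord_continuous _ _ _ j 0 _)).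
Qed.

Lemma height_ge_len : exists2 c, 0 < c & forall w, c * (len w)%:R <= height w.
Proof.
have [D D0 [c c0 growth]] := orbit_height_growth Bcox rhoB Bsig oneg.
exists c => // w; apply: le_trans (growth w); rewrite ler_wpM2l ?(ltW c0)//.
have [->|k0] := posnP (len w); first by rewrite mul0r.
rewrite ler_peMr//; apply: (@le_trans _ _ (nat_root R D 1)).
  by rewrite /nat_root powR1.
exact: nat_root_mono.
Qed.

(** The form at an orbit point is [la] over the squared height, and heights tend to infinity with
    the length. *)
Lemma seq_limit_isotropic (x : gseq R W) : bform B (seq_limit x) (seq_limit x) = 0.
Proof.
have [c c0 hc] := height_ge_len; have [la la0 Bo] := bform_o Bcox oneg.
apply/eqP; rewrite -normr_le0; apply/ler_addgt0Pr => e e0; rewrite add0r.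
have Bx : `|bform B (pt (val x k)) (pt (val x k))| @[k --> \oo] -->
    `|bform B (seq_limit x) (seq_limit x)|.
  by apply: cvg_norm; apply: cvg_bform; exact: seq_limitP.
rewrite -(cvg_lim _ Bx)//; apply: limr_le; first exact: cvgP Bx.
pose M := Num.max 1 (- la / (c ^+ 2 * e)).
(* On the diagonal the Gromov product of an element with itself is its length, so lengths are
   eventually at least [M]. *)
have /gromov_seqP/(_ M)[N NP] := asboolW (valP x).
exists N => // k /= Nk; have := NP k k Nk Nk.
rewrite /gromov_product /word_dist mulVg word_length1 subr0 mulg1 word_lengthV.
rewrite -mulr2n -[X in X / 2]mulr_natr mulfK ?pnatr_eq0//.
rewrite /M ge_max => /andP[]; set L := (len _)%:R => L1 LM.
rewrite (bform_pt _ Bcox rhoB) mulVg (rho1 rhoB) mul1mx Bo (norm1_o oneg) mulr1.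
have hL := hc (val x k); rewrite -/L in hL.
have h0 := orbit_height_gt0 Bcox rhoB oneg (val x k).
rewrite normrM normfV ltr0_norm// gtr0_norm ?mulr_gt0// ler_pdivrMr ?mulr_gt0//.
have cL : (c * L) ^+ 2 <= height (val x k) * height (val x k).
  by rewrite expr2 ler_pM// mulr_ge0// ltW// (lt_le_trans ltr01).
have LL : L <= L ^+ 2 by rewrite expr2 ler_peMr// (le_trans ler01).
move: LM; rewrite ler_pdivrMr ?mulr_gt0 ?exprn_gt0// => LM.
apply: le_trans (_ : e * (c * L) ^+ 2 <= _); last by rewrite ler_wpM2l// ltW.
apply: le_trans LM _.
have -> : L * (c ^+ 2 * e) = e * c ^+ 2 * L by ring.
have -> : e * (c * L) ^+ 2 = e * c ^+ 2 * L ^+ 2 by ring.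
by rewrite ler_wpM2l// mulr_ge0 ?sqr_ge0// ltW.
Qed.

Lemma seq_limit_norm1 (x : gseq R W) : h (seq_limit x) = 1.
Proof.
have /(cvg_lim (@Rhausdorff R)) <- := cvg_norm1 (seq_limitP (x := x)).
rewrite (_ : (fun k => _) = cst 1) ?lim_cst//.
by apply/funext => k; rewrite (norm1_pt Bcox rhoB oneg).
Qed.

(** The form is negative on the orbit and 0 at the limit. This is needed because a limit point must
    be approached by points different from it. *)
Lemma seq_limit_neq_pt (x : gseq R W) w : pt w <> seq_limit x.
Proof.
move=> e; have := seq_limit_isotropic x; rewrite -e (bform_pt _ Bcox rhoB).
have [la la0 Bo] := bform_o Bcox oneg.
rewrite mulVg (rho1 rhoB) mul1mx Bo (norm1_o oneg) mulr1 => /eqP.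
by rewrite mulf_eq0 invr_eq0 mulf_eq0 orbb lt_eqF//= gt_eqF// (orbit_height_gt0 Bcox rhoB oneg).
Qed.

(** An isotropic vector of height 0 vanishes, whereas [rho w] is invertible. Nonvanishing makes the
    normalization continuous at this vector. *)
Lemma norm1_rho_seq_limit (x : gseq R W) w : h (rho w *m seq_limit x) != 0.
Proof.
apply/eqP => hw.
have [w0|/(posdef Bcox Bsig oneg hw)] := eqVneq (rho w *m seq_limit x) 0; last first.
  by rewrite (bform_rho Bcox rhoB) seq_limit_isotropic ltxx.
have := seq_limit_norm1 x; rewrite -(rhoVK rhoB w (seq_limit x)) w0 mulmx0.
by rewrite -(scale0r o) norm1Z mul0r => /eqP; rewrite eq_sym oner_eq0.
Qed.

Lemma pt_mul w g : pt (w * g)%g = normalize o (rho w *m pt g).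
Proof.
have a0 : height g != 0 by rewrite gt_eqF// (orbit_height_gt0 Bcox rhoB oneg).
rewrite /normalized_action /normalize -scalemxAr norm1Z mulmxA -(rhoM rhoB).
by rewrite scalerA invfM invrK mulrAC mulfV// mul1r.
Qed.

Lemma boundary_map_equivariant w (a : bdry) :
  boundary_map (boundary_action w a) = normalized_action rho o w (boundary_map a).
Proof.
rewrite -[a in LHS]reprK [LHS]/boundary_map.
rewrite -/(boundary_class (repr a)) boundary_actionE -/(boundary_map _) boundary_mapE.
apply: cvg_lim => //=.
under eq_cvg do rewrite pt_mul.
have cw := cvg_mulmx (A := rho w) (seq_limitP (x := repr a)).
apply: cvgZ => //; apply: cvgV; first exact: norm1_rho_seq_limit.
exact: cvg_norm1.
Qed.

Lemma limit_set_seq_limit (x : gseq R W) : limit_set rho o (seq_limit x).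
Proof.
move=> U Ux; have [N _ NU] := seq_limitP Ux.
exists (pt (val x N)); split; [exact/eqP/seq_limit_neq_pt|by exists (val x N)|].
exact: (NU N (leqnn N)).
Qed.

(** * Surjectivity onto the limit set *)

Section LimitPoint.
Variable z : 'cV[R]_n.
Hypothesis zL : limit_set rho o z.

(** Additivity of lengths says that [v] is a prefix of a reduced word of [g]. Requiring [pt g != z]
    for every [e] forces infinitely many such [g]. *)
Let prefix_near (v : W) := forall e : R, 0 < e -> exists g w,
  [/\ g = (v * w)%g, len g = (len v + len w)%N, pt g != z & `|z - pt g| <= e].

Let prefix_near1 : prefix_near 1%g.
Proof.
move=> e e0; have : nbhs z [set y | `|z - y| < e].
  by apply/nbhs_ballP; exists e => //= y; rewrite -ball_normE.
move=> /zL[y [yz [g _ gy] /= zg]]; exists g, g.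
by rewrite gy mul1g word_length1 add0n ltW.
Qed.

(** There are finitely many next letters: if each failed below its own threshold [f i], an element
    [g] closer to [z] than all thresholds would have no next letter. *)
Let prefix_near_step (v : W) : prefix_near v ->
  exists i, len (v * gen i)%g = (len v).+1 /\ prefix_near (v * gen i)%g.
Proof.
move=> vz.
pose Q i (e : R) := exists g w, [/\ g = (v * gen i * w)%g,
  len g = ((len v).+1 + len w)%N, pt g != z & `|z - pt g| <= e].
suff [i Qi] : exists i, forall e : R, 0 < e -> Q i e.
  have lvi : len (v * gen i)%g = (len v).+1.
    have [g [w [gE gl _ _]]] := Qi 1 ltr01.
    have := word_lengthM (v * gen i)%g w; rewrite -gE gl leq_add2r => le1.
    by apply/eqP; rewrite eqn_leq le1 word_lengthMgen_le.
  by exists i; split=> // e e0; rewrite lvi; exact: Qi.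
apply: contrapT => noQ.
have [f fP] : {f : 'I_n -> R & forall i, 0 < f i /\ ~ Q i (f i)}.
  apply: (@choice _ _ (fun i e => 0 < e /\ ~ Q i e)) => i.
  apply: contrapT => noe; apply: noQ; exists i => e e0.
  by apply: contrapT => nQ; apply: noe; exists e.
(* [d] excludes [g = v], which has no next letter; if [pt v] is [z], the condition [pt g != z]
   already does so and any positive value serves. *)
pose d := if pt v == z then 1 else `|z - pt v| / 2.
have d0 : 0 < d.
  rewrite /d; case: eqVneq => // vnz; rewrite divr_gt0// normr_gt0 subr_eq0.
  by rewrite eq_sym.
pose e := \big[Num.min/d]_i f i.
have e0 : 0 < e by apply: lt_bigmin => // i _; have [] := fP i.
have [g [w [gE gl gz ge]]] := vz e e0.
have [x xw xl] := reduced_word w; case: x => [|i x] in xw xl *.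
  move: xw; rewrite /word_prod big_nil => w1; move: gE; rewrite -w1 mulg1 => gv.
  have : `|z - pt v| <= d by rewrite -gv (le_trans ge)// bigmin_le_id.
  rewrite /d -gv (negbTE gz) => zz.
  have : 0 < `|z - pt g| by rewrite normr_gt0 subr_eq0 eq_sym.
  by rewrite gv in zz *; lra.
have [_ rx] : reduced W [:: i] /\ reduced W x.
  by apply: reduced_cat; rewrite /reduced xw xl.
have [_] := fP i; apply; exists g, (word_prod W x); split=> //.
- by rewrite gE -xw word_prod_cons mulgA.
- by rewrite gl -xl rx /= addnS addSn.
- by apply: le_trans ge _; exact: bigmin_le.
Qed.

(* Koenig's lemma: a geodesic ray all of whose points are prefixes of orbit
   elements converging to [z]. *)
Lemma limit_point_seq_limit : exists x : gseq R W, seq_limit x = z.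
Proof.
(* [i0] is a default letter for the choice function at elements that are not [prefix_near]. *)
have [i0 _] := prefix_near_step prefix_near1.
have [s sP] : {s : W -> 'I_n & forall v : W, prefix_near v ->
    len (v * gen (s v))%g = (len v).+1 /\ prefix_near (v * gen (s v))%g}.
  apply: (@choice _ _ (fun (v : W) i => prefix_near v ->
    len (v * gen i)%g = (len v).+1 /\ prefix_near (v * gen i)%g)) => v.
  have [/prefix_near_step[i vi]|nv] := pselect (prefix_near v); first by exists i.
  by exists i0.
pose ray k := iter k (fun v : W => v * gen (s v))%g (1%g : W).
have rayP k : len (ray k) = k /\ prefix_near (ray k).
  elim: k => [|k [lk ak]]; first by rewrite /= word_length1.
  by have [lk1 ak1] := sP _ ak; split; rewrite //= lk1 lk.
have ray_le k d : (len ((ray k)^-1 * ray (k + d)%N)%g <= d)%N.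
  elim: d => [|d IH]; first by rewrite addn0 mulVg word_length1.
  by rewrite addnS /= mulgA (leq_trans (word_lengthMgen_le _ _)).
have [x xP] : {x : nat -> W & forall k, exists w,
    [/\ x k = (ray k * w)%g, len (x k) = (k + len w)%N & `|z - pt (x k)| <= k.+1%:R^-1]}.
  apply: (@choice _ _ (fun k g => exists w, [/\ g = (ray k * w)%g,
    len g = (k + len w)%N & `|z - pt g| <= k.+1%:R^-1])) => k.
  have [lk /(_ k.+1%:R^-1)] := rayP k; rewrite invr_gt0 ltr0n lk.
  by move=> /(_ isT)[g [w [gE gl _ gz]]]; exists g, w.
have x_le k l : (k <= l)%N -> (len ((ray k)^-1 * x l)%g + k <= len (x l))%N.
  move=> kl; have [w [xE -> _]] := xP l; rewrite xE mulgA.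
  have := word_lengthM ((ray k)^-1 * ray l)%g w.
  have := ray_le k (l - k)%N; rewrite subnKC//.
  by move: (len _) (len _) (len _); lia.
(* Beyond [N] all terms share the prefix [ray N] of length [N], so their Gromov products are at
   least [N]. *)
have xG : gromov_seq R x.
  apply/gromov_seqP => M; exists (Num.truncn M).+1 => k l Mk Ml.
  apply: le_trans (ltW (truncnS_gt M)) _; set N := (Num.truncn M).+1 in Mk Ml *.
  rewrite ler_pdivlMr// lerBrDr -!natrD -natrM -natrD ler_nat.
  rewrite /word_dist !mulg1 !word_lengthV.
  have -> : ((x k)^-1 * x l = ((ray N)^-1 * x k)^-1 * ((ray N)^-1 * x l))%g.
    by rewrite invgM invgK -mulgA mulVKg.
  have := word_lengthM ((ray N)^-1 * x k)^-1%g ((ray N)^-1 * x l)%g.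
  rewrite word_lengthV; have := x_le _ _ Mk; have := x_le _ _ Ml.
  by move: (len _) (len _) (len _) (len _) (len _); lia.
exists (exist _ x (asboolT xG)); apply: cvg_lim => //=.
apply/cvgrPdist_le => e e0; exists (Num.truncn e^-1) => // k /= ek.
have [w [_ _ /le_trans]] := xP k; apply.
rewrite invf_ple ?posrE ?ltr0n//.
by apply: le_trans (ltW (truncnS_gt _)) _; rewrite ler_nat ltnS.
Qed.

End LimitPoint.

Lemma range_boundary_map : range boundary_map = limit_set rho o.
Proof.
apply/seteqP; split=> [_ [a _ <-]|z /limit_point_seq_limit[x <-]].
  exact: limit_set_seq_limit.
by exists (boundary_class x); rewrite // boundary_mapE.
Qed.

End BoundaryMap.

Theorem theorem1p1 (R : realType) (n : nat) (m : coxeterMatrix n)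
    (W : coxeterSystem m) (B : 'M[R]_n) (rho : W -> 'M[R]_n) (o : 'cV[R]_n) :
  coxeter_form m B ->
  geometric_action B rho ->
  signature B n.-1 1 ->
  irreducible_form B ->
  negative_direction B o ->
  (forall A : {set 'I_n}, (3 <= #|A|)%N ->
     positive_definite (gram_restr B A) \/
     signature (gram_restr B A) #|A|.-1 1) ->
  exists F : gromov_boundary R W -> 'cV[R]_n,
    [/\ continuous F,
        range F = limit_set rho o &
        forall (w : W) (a : gromov_boundary R W),
          F (boundary_action w a) = normalized_action rho o w (F a)].
Proof.
move=> Bcox rhoB Bsig _ oneg _; exists (boundary_map rho o); split.
- exact: (boundary_map_continuous Bcox rhoB Bsig oneg).
- exact: (range_boundary_map Bcox rhoB Bsig oneg).
- exact: (boundary_map_equivariant Bcox rhoB Bsig oneg).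
Qed.
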